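(* Let $k\ge 3$ and $G=\mathbb{Z}/k\mathbb{Z}\star\mathbb{Z}/k\mathbb{Z}$, with $a$ and $b$ generators of the first and second cyclic factor respectively, and let $\Sigma=\{a,\dots,a^{k-1},b,\dots,b^{k-1}\}$. Let $\mu$ be the probability measure with $\mu(a)=\mu(a^{-1})=\mu(b)=\mu(b^{-1})=1/4$. Define $F_n:[0,1]\to\mathbb{R}$, $n\in\mathbb{N}$, by $$F_0(x)=1,\qquad F_1(x)=x,\qquad F_n(x)=2(2-x)F_{n-1}(x)-F_{n-2}(x)\quad (n\ge 2),$$ and let $x_k$ be the unique solution in $(0,1)$ of $F_k(x)=1$. Then the harmonic measure of the random walk $(G,\mu)$ is the Markovian multiplicative measure associated with the vector $r$ given by $$r(a^i)=r(b^i)=\frac{F_i(x_k)}{2},\qquad i\in\{1,\dots,k-1\}.$$ The drift of the walk (with respect to $\Sigma$) is $\gamma_k=(1-x_k)/2$. Moreover $\gamma_k$ is a strictly increasing function of $k$ and $\lim_{k\to\infty}\gamma_k=1/3$.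
   Context: For a free product $G=G_1\star G_2$ of two nontrivial finite groups, put $\Sigma_i=G_i\setminus\{1\}$ and $\Sigma=\Sigma_1\sqcup\Sigma_2$; for $u\in\Sigma$, $\Sigma_u$ denotes the $\Sigma_i$ containing $u$. Every $g\in G$ has a unique normal form $g=u_1\cdots u_n$ with $u_j\in\Sigma$ and $u_{j+1}\notin\Sigma_{u_j}$; its length with respect to $\Sigma$ is $|g|=n$. Random walk $(G,\mu)$: $X_0=1$, $X_{n+1}=X_nx_n$ with $(x_n)$ i.i.d. of law $\mu$. The drift is $\gamma=\lim_n |X_n|/n$ (a.s.). When the walk is transient, the normal form of $X_n$ converges a.s., letter by letter, to an infinite normal form word $X_\infty\in\Sigma^{\mathbb{N}}$ (an infinite word with $u_{j+1}\notin\Sigma_{u_j}$ for all $j$); the harmonic measure $\mu^\infty$ is the law of $X_\infty$. For a vector $r\in(0,1)^\Sigma$ with $\sum_{u\in\Sigma}r(u)=1$, write $r(E)=\sum_{u\in E}r(u)$ for $E\subset\Sigma$ and $q(u)=r(u)/r(\Sigma\setminus\Sigma_u)$. The Markovian multiplicative measure associated with $r$ is the probability measure $\nu$ on infinite normal form words such that $\nu(u_1\cdots u_n\Sigma^{\mathbb{N}})=q(u_1)\cdots q(u_{n-1})\,r(u_n)$ for every finite normal form word $u_1\cdots u_n$, where $u_1\cdots u_n\Sigma^{\mathbb{N}}$ is the set of infinite words with prefix $u_1\cdots u_n$. *)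

(* Defs.v *)
From HB Require Import structures.
From mathcomp Require Import all_boot all_order all_algebra all_fingroup all_solvable.
From mathcomp Require Import all_classical all_reals all_analysis.
Set Implicit Arguments.
Unset Strict Implicit.
Unset Printing Implicit Defensive.
Import Order.TTheory GRing.Theory Num.Theory.
Import numFieldNormedType.Exports.
Local Open Scope classical_set_scope.
Local Open Scope ring_scope.

(* The disjoint union gT1 + gT2 also contains the two trivial elements; the   *)
(* alphabet of the normal forms is the subset Sigma below.                    *)
Section Letters.
Variables gT1 gT2 : finGroupType.
Implicit Types u v : gT1 + gT2.

Definition nontrivial u : bool :=
  match u with inl x => x != 1%g | inr y => y != 1%g end.

Definition same_factor u v : bool :=
  match u, v with inl _, inl _ | inr _, inr _ => true | _, _ => false end.

Definition Sigma : {set gT1 + gT2} := [set u | nontrivial u]%SET.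

Definition Sigma_of u : {set gT1 + gT2} :=
  [set v in Sigma | same_factor u v]%SET.

Definition letter_mul u v : option (gT1 + gT2) :=
  match u, v with
  | inl x, inl y => Some (inl (x * y)%g)
  | inr x, inr y => Some (inr (x * y)%g)
  | _, _ => None
  end.

Definition letter_inv u : gT1 + gT2 :=
  match u with inl x => inl (x^-1)%g | inr y => inr (y^-1)%g end.

Definition normal_form (w : seq (gT1 + gT2)) : bool :=
  all nontrivial w && sorted (fun u v => ~~ same_factor u v) w.

(* left multiplication of the normal form w by the group element u *)
Definition mul_letter u (w : seq (gT1 + gT2)) : seq (gT1 + gT2) :=
  if nontrivial u then
    if w is v :: w' then
      if letter_mul u v is Some p then
        if nontrivial p then p :: w' else w'
      else u :: w
    else [:: u]
  else w.

Definition word_mul (w1 w2 : seq (gT1 + gT2)) : seq (gT1 + gT2) :=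
  foldr mul_letter w2 w1.

Definition word_inv (w : seq (gT1 + gT2)) : seq (gT1 + gT2) :=
  rev (map letter_inv w).

Lemma normal_form_cons u w : normal_form (u :: w) ->
  nontrivial u /\ normal_form w.
Proof.
by rewrite /normal_form /= => /andP[/andP[-> ->]] /path_sorted ->.
Qed.

Lemma letter_mul_same u v p : letter_mul u v = Some p ->
  same_factor u v /\ same_factor p =1 same_factor v.
Proof. by case: u v => [x|x] [y|y] //= [<-]. Qed.

Lemma mul_letter_nf u w : normal_form w -> normal_form (mul_letter u w).
Proof.
rewrite /mul_letter; case: ifP => // ntu.
case: w => [|v w] nfw; first by rewrite /normal_form /= ntu.
case E: (letter_mul u v) => [p|].
  have [_ sp] := letter_mul_same E.
  case: ifP => ntp; last by case: (normal_form_cons nfw).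
  move: nfw; rewrite /normal_form /= ntp => /andP[/andP[_ ->]] /=.
  by case: w => //= z w; rewrite sp.
move: nfw; rewrite /normal_form /= ntu => /andP[-> ->]; rewrite andbT.
by case: u v E {ntu} => [x|x] [y|y].
Qed.

Lemma word_mul_nf w1 w2 : normal_form w2 -> normal_form (word_mul w1 w2).
Proof. by move=> nf2; elim: w1 => //= u w IH; apply: mul_letter_nf. Qed.

Lemma word_inv_nf w : normal_form w -> normal_form (word_inv w).
Proof.
rewrite /normal_form /word_inv all_rev all_map rev_sorted sorted_map.
move=> /andP[ntw sw]; apply/andP; split.
  by apply: sub_all ntw => -[x|x] /=; rewrite invg_eq1.
by apply: sub_sorted sw => -[x|x] [y|y].
Qed.

Lemma mul_letterM u v p w : letter_mul u v = Some p -> normal_form w ->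
  mul_letter u (mul_letter v w) = mul_letter p w.
Proof.
rewrite /mul_letter.
case: u v => [x|x] [y|y] //= [<-] nfw /=.
- have [->|nx] := eqVneq x 1%g; first by rewrite mul1g.
  have [->|ny] /= := eqVneq y 1%g; first by rewrite mulg1 nx.
  case: w nfw => [|[z|z] w] nfw /=; [by [] | | by case: eqP].
  have [yz1|nyz] /= := eqVneq (y * z)%g 1%g; last first.
    rewrite mulgA; have [xy1|//] := eqVneq (x * y)%g 1%g.
    rewrite xy1 mul1g.
    by case: (normal_form_cons nfw) => /= ->.
  have zE : z = (y^-1)%g by apply: (mulgI y); rewrite yz1 mulgV.
  have [xy1|nxy] /= := eqVneq (x * y)%g 1%g.
    have -> : x = z by apply/(mulIg y); rewrite xy1 zE mulVg.
    by case: w nfw => [|[t|t] w] //=; rewrite /normal_form /= !andbF.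
  rewrite zE mulgK nx.
  by case: w nfw => [|[t|t] w] //=; rewrite /normal_form /= !andbF.
- have [->|nx] := eqVneq x 1%g; first by rewrite mul1g.
  have [->|ny] /= := eqVneq y 1%g; first by rewrite mulg1 nx.
  case: w nfw => [|[z|z] w] nfw /=; [by [] | by case: eqP | ].
  have [yz1|nyz] /= := eqVneq (y * z)%g 1%g; last first.
    rewrite mulgA; have [xy1|//] := eqVneq (x * y)%g 1%g.
    rewrite xy1 mul1g.
    by case: (normal_form_cons nfw) => /= ->.
  have zE : z = (y^-1)%g by apply: (mulgI y); rewrite yz1 mulgV.
  have [xy1|nxy] /= := eqVneq (x * y)%g 1%g.
    have -> : x = z by apply/(mulIg y); rewrite xy1 zE mulVg.
    by case: w nfw => [|[t|t] w] //=; rewrite /normal_form /= !andbF.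
  rewrite zE mulgK nx.
  by case: w nfw => [|[t|t] w] //=; rewrite /normal_form /= !andbF.
Qed.

Lemma mul_letter_word_mul u w1 w2 : normal_form w2 ->
  word_mul (mul_letter u w1) w2 = mul_letter u (word_mul w1 w2).
Proof.
move=> nf2; rewrite {1}/mul_letter; case: ifP => ntu; last first.
  by rewrite /mul_letter ntu.
case: w1 => [//|v w1].
case E: (letter_mul u v) => [p|//] /=.
rewrite (mul_letterM E) ?word_mul_nf //.
by case: ifP => ntp //=; rewrite /mul_letter ntp.
Qed.

Lemma word_mulA w1 w2 w3 : normal_form w3 ->
  word_mul w1 (word_mul w2 w3) = word_mul (word_mul w1 w2) w3.
Proof. by move=> nf3; elim: w1 => //= u w ->; rewrite mul_letter_word_mul. Qed.

Lemma word_mul1 w : normal_form w -> word_mul w [::] = w.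
Proof.
elim: w => //= u w IH nfw; have [ntu nfw'] := normal_form_cons nfw.
rewrite IH // /mul_letter ntu; case: w nfw {IH nfw'} => // v w.
by case: u v {ntu} => [x|x] [y|y] //=; rewrite /normal_form /= !andbF.
Qed.

Lemma word_mulV w : normal_form w -> word_mul (word_inv w) w = [::].
Proof.
elim: w => //= u w IH nfw; have [ntu nfw'] := normal_form_cons nfw.
rewrite /word_inv /= rev_cons /word_mul foldr_rcons.
suff -> : mul_letter (letter_inv u) (u :: w) = w by exact: IH.
rewrite /mul_letter.
by case: u ntu {nfw} => x /= nx; rewrite invg_eq1 nx mulVg eqxx.
Qed.

Lemma word_invK : involutive word_inv.
Proof.
move=> w; rewrite /word_inv map_rev revK -map_comp map_id_in //.
by move=> [x|x] _ /=; rewrite invgK.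
Qed.

End Letters.

Record free_product (gT1 gT2 : finGroupType) := FreeProduct {
  nf :> seq (gT1 + gT2);
  nfP : normal_form nf }.

HB.instance Definition _ gT1 gT2 := [isSub for @nf gT1 gT2].
HB.instance Definition _ gT1 gT2 := [Countable of free_product gT1 gT2 by <:].

Section FreeProductGroup.
Variables gT1 gT2 : finGroupType.
Local Notation G := (free_product gT1 gT2).

Definition fp_one : G := @FreeProduct gT1 gT2 [::] isT.
Definition fp_mul (g h : G) : G := FreeProduct (word_mul_nf g (nfP h)).
Definition fp_inv (g : G) : G := FreeProduct (word_inv_nf (nfP g)).

Fact fp_mulA : associative fp_mul.
Proof. by move=> f g h; apply: val_inj; rewrite /= word_mulA ?nfP. Qed.

Fact fp_mul1g : left_id fp_one fp_mul.
Proof. by move=> g; apply: val_inj. Qed.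

Fact fp_mulg1 : right_id fp_one fp_mul.
Proof. by move=> g; apply: val_inj; rewrite /= word_mul1 ?nfP. Qed.

Fact fp_mulVg : left_inverse fp_one fp_inv fp_mul.
Proof. by move=> g; apply: val_inj; rewrite /= word_mulV ?nfP. Qed.

Fact fp_mulgV : right_inverse fp_one fp_inv fp_mul.
Proof.
move=> g; apply: val_inj => /=.
by rewrite -{1}[nf g]word_invK word_mulV ?word_inv_nf ?nfP.
Qed.

HB.instance Definition _ :=
  isGroup.Build G fp_mulA fp_mul1g fp_mulg1 fp_mulVg fp_mulgV.

HB.instance Definition _ := isPointed.Build G fp_one.

HB.instance Definition _ := @isMeasurable.Build default_measure_display
  G discrete_measurable discrete_measurable0
  discrete_measurableC discrete_measurableU.

(* the canonical embeddings of the two factors; both identities go to 1 *)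
Definition fp_letter (u : gT1 + gT2) : G := insubd fp_one [:: u].

Lemma fp_letterE u : nf (fp_letter u) = if nontrivial u then [:: u] else [::].
Proof.
by rewrite /fp_letter -[LHS]/(val _) val_insubd /normal_form /= !andbT.
Qed.

Lemma fp_letter_inl1 : fp_letter (inl 1%g) = 1%g.
Proof. by apply: val_inj; rewrite /= fp_letterE /= eqxx. Qed.

Lemma fp_letter_inr1 : fp_letter (inr 1%g) = 1%g.
Proof. by apply: val_inj; rewrite /= fp_letterE /= eqxx. Qed.

Lemma nf_fp_letterM u (g : G) : nf (fp_letter u * g)%g = mul_letter u g.
Proof.
rewrite -[LHS]/(word_mul (fp_letter u) g) fp_letterE.
by rewrite [in RHS]/mul_letter; case: ifP => //= ntu; rewrite /mul_letter ntu.
Qed.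

Lemma fp_letter_mul u v p : letter_mul u v = Some p ->
  fp_letter p = (fp_letter u * fp_letter v)%g.
Proof.
move=> E; apply: val_inj; rewrite -![val _]/(nf _).
rewrite nf_fp_letterM -[fp_letter v]mulg1 nf_fp_letterM (mul_letterM E) //.
by rewrite -nf_fp_letterM mulg1.
Qed.

Lemma fp_prodE (g : G) : g = (\prod_(u <- nf g) fp_letter u)%g.
Proof.
apply: val_inj => /=; rewrite -[LHS]word_mul1 ?nfP //.
elim: (nf g) => [|u w IH] /=; first by rewrite big_nil.
by rewrite big_cons nf_fp_letterM IH.
Qed.

End FreeProductGroup.

Section InfiniteWords.
Variables gT1 gT2 : finGroupType.

HB.instance Definition _ :=
  isPointed.Build (gT1 + gT2)%type (inl 1%g).

(* All sequences over gT1 + gT2, with the product sigma-algebra (each factor  *)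
(* being finite and discrete); normal forms are carved out by                 *)
(* infinite_normal_form, and markovian_multiplicative asks that they have     *)
(* full measure.                                                              *)
Definition infinite_word :=
  g_sigma_algebraType [set A : set (nat -> gT1 + gT2) |
    exists n u, A = [set w | w n = u]].

HB.instance Definition _ := Measurable.on infinite_word.

Definition infinite_normal_form : set infinite_word :=
  [set w | forall j, nontrivial (w j) /\ ~~ same_factor (w j) (w j.+1)].

Definition cylinder (s : seq (gT1 + gT2)) : set infinite_word :=
  [set w | mkseq w (size s) = s].

End InfiniteWords.

Section Multiplicative.
Variables (R : realType) (gT1 gT2 : finGroupType).
Variable r : gT1 + gT2 -> R.

Definition mass (E : {set gT1 + gT2}) : R := \sum_(u in E) r u.

Definition qweight (u : gT1 + gT2) : R :=
  r u / mass (Sigma gT1 gT2 :\: Sigma_of u)%SET.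

Definition markovian_multiplicative
    (nu : probability (infinite_word gT1 gT2) R) : Prop :=
  [/\ forall u, u \in Sigma gT1 gT2 -> 0 < r u < 1,
      mass (Sigma gT1 gT2) = 1,
      nu (@infinite_normal_form gT1 gT2) = 1%E &
      forall (s : seq (gT1 + gT2)) (u : gT1 + gT2), normal_form (rcons s u) ->
        nu (cylinder (rcons s u)) = ((\prod_(v <- s) qweight v) * r u)%:E].

End Multiplicative.

Section Walk.
Variables (R : realType) (gT1 gT2 : finGroupType).
Local Notation G := (free_product gT1 gT2).
Variables (d : measure_display) (T : measurableType d) (P : probability T R).

Definition iid (mu : probability G R) (x : nat -> {RV P >-> G}) : Prop :=
  (forall n (A : set G), measurable A -> distribution P (x n) A = mu A) /\
  (forall (s : seq nat) (A : nat -> set G), uniq s ->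
     (forall i, measurable (A i)) ->
     P (\bigcap_(i in [set` s]) (x i @^-1` A i))
     = (\prod_(i <- s) P (x i @^-1` A i))%E).

Fixpoint walk (x : nat -> T -> G) (n : nat) (t : T) : G :=
  if n is m.+1 then (walk x m t * x m t)%g else 1%g.

Definition is_drift (X : nat -> T -> G) (gamma : R) : Prop :=
  {ae P, forall t, (size (X n t))%:R / n%:R @[n --> \oo] --> gamma}.

Definition converges_letterwise (g : nat -> G) (w : infinite_word gT1 gT2) :
    Prop :=
  forall j : nat, \forall n \near \oo,
    (j < size (g n))%N /\ nth (inl 1%g) (g n) j = w j.

Definition harmonic_measure (X : nat -> T -> G)
    (nu : probability (infinite_word gT1 gT2) R) : Prop :=
  exists Xoo : {RV P >-> infinite_word gT1 gT2},
    {ae P, forall t, converges_letterwise (X ^~ t) (Xoo t)} /\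
    (forall A, measurable A -> nu A = distribution P Xoo A).

End Walk.

(* F is only used on [0, 1]; the recursion makes sense on the whole of R. *)
Fixpoint F (R : realType) (n : nat) (x : R) : R :=
  match n with
  | 0 => 1
  | 1 => x
  | (m.+1 as p).+1 => 2 * (2 - x) * F p x - F m x
  end.

(* Main.v *)
(* Each step of the walk only acts on the last letter of the normal form, so the
   increments of a functional that is additive or multiplicative over the letters
   depend on that letter alone.  With the letter weights w(a^i) = i (k - i) the
   additive functional is, off the identity, a martingale plus the drift
   (k - 2) / 2; hence the length of X_n tends to infinity and its letters
   stabilise.  With q(a^i) = F_i(x_k) the multiplicative functional of g^-1 h is
   harmonic in h off g (it is the probability of hitting g from h), which gives
   an explicit harmonic function h |-> P_h(X_oo has prefix g); being a bounded
   martingale along the walk, it yields the law of X_oo.  Under this law the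
   exponents of X_oo are i.i.d. with distribution F_i(x_k), so the mean weight of
   a letter of X_oo is (k - 2) / (1 - x_k), and comparing with the drift of the
   total weight gives the drift (1 - x_k) / 2 of the length.  Both averages come
   from a second moment bound along the squares.
   The substitution x = (1 - 3 s) / (1 - s) turns F_k(x) = 1 into rho_k(s) = 2,
   where rho_k(tanh^2(theta/2)) = tanh(k theta/2) / tanh(theta/2) decreases in s
   and increases in k. *)

From HB Require Import structures.
Require Import Defs.
From mathcomp Require Import all_boot all_order all_algebra all_fingroup all_solvable.
From mathcomp Require Import all_classical all_reals all_analysis.
From mathcomp Require Import measurable_realfun ring lra zify.
Import Order.TTheory GRing.Theory Num.Theory.
Import numFieldNormedType.Exports.
Local Open Scope classical_set_scope.
Local Open Scope ring_scope.

(** * The equation F k x = 1 *)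

Section Roots.
Variable R : realType.
Implicit Types s x y : R.

(** The recursion is the addition formula of tanh, rescaled by t = tanh(theta/2) with s = t^2; it
    also makes sense at s = 0, where it gives n. *)
Fixpoint rho (n : nat) s : R :=
  if n is m.+1 then (rho m s + 1) / (1 + s * rho m s) else 0.

Lemma rho_ge0 n s : 0 <= s -> 0 <= rho n s.
Proof.
move=> s0; elim: n => //= n IH.
by rewrite divr_ge0 ?addr_ge0 ?mulr_ge0.
Qed.

Lemma rho_gt0 n s : 0 <= s -> (0 < n)%N -> 0 < rho n s.
Proof.
case: n => // n s0 _ /=; have r0 := rho_ge0 n s s0.
by rewrite divr_gt0 ?(ltr_wpDl r0) ?ltr_wpDr ?mulr_ge0.
Qed.

(** Each step multiplies the gap 1 - s rho^2 by (1 - s) / (1 + s rho)^2, so the gap stays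
    positive. *)
Lemma rho_sqr_lt1 n s : 0 <= s < 1 -> s * rho n s ^+ 2 < 1.
Proof.
move=> /andP[s0 s1]; elim: n => [|n IH] /=; first by rewrite expr0n mulr0.
have r0 := rho_ge0 n s s0; move: (rho n s) IH r0 => p IH p0.
have d0 : 0 < 1 + s * p by rewrite ltr_wpDr ?mulr_ge0.
rewrite expr_div_n mulrA ltr_pdivrMr ?exprn_gt0 // mul1r -subr_gt0.
have -> : (1 + s * p) ^+ 2 - s * (p + 1) ^+ 2 = (1 - s) * (1 - s * p ^+ 2).
  by ring.
by rewrite mulr_gt0 ?subr_gt0.
Qed.

Lemma ltr_rhoS n s : 0 <= s < 1 -> rho n s < rho n.+1 s.
Proof.
move=> s01; have [s0 _] := andP s01.
have r0 := rho_ge0 n s s0; have := rho_sqr_lt1 n s s01.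
rewrite /=; move: (rho n s) r0 => p p0 h.
rewrite ltr_pdivlMr; first by nra.
by rewrite ltr_wpDr ?mulr_ge0.
Qed.

Lemma ltr_rho m n s : 0 <= s < 1 -> (m < n)%N -> rho m s < rho n s.
Proof.
move=> s01; elim: n => // n IH; rewrite ltnS leq_eqVlt => /orP[/eqP->|/IH h].
  exact: ltr_rhoS.
exact: lt_trans h (ltr_rhoS _ _ s01).
Qed.

(** The map p -> (p + 1) / (1 + s p) increases with p and, where p > 0, strictly decreases with s.
    As [rho 1] is constant, strictness only starts at n = 2, so the induction pairs a weak
    inequality at m with a strict one at m + 2. *)
Lemma rho_decr n s s' : (1 < n)%N -> 0 <= s -> s < s' -> s' < 1 ->
  rho n s' < rho n s.
Proof.
case: n => [|[|n]] // _ s0 ss' s'1; have s'0 := le_lt_trans s0 ss'.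
have s1 := lt_trans ss' s'1.
suff h m : rho m s' <= rho m s /\ rho m.+2 s' < rho m.+2 s by exact: (h n).2.
have step p p' : 0 <= p' -> p' <= p -> 
   (p' + 1) / (1 + s' * p') <= (p + 1) / (1 + s * p)
   /\ (0 < p' -> (p' + 1) / (1 + s' * p') < (p + 1) / (1 + s * p)).
  move=> p0 pp.
  have d0 : 0 < 1 + s * p by nra.
  have d'0 : 0 < 1 + s' * p' by nra.
  have E : (p + 1) * (1 + s' * p') - (p' + 1) * (1 + s * p) =
           (p - p') * (1 - s) + (s' - s) * p' * (p + 1) by ring.
  have h1 : 0 <= (p - p') * (1 - s) by rewrite mulr_ge0 ?subr_ge0 ?(ltW s1).
  have p1 : 0 < p + 1 by rewrite ltr_wpDl ?(le_trans p0).
  have h2 : 0 <= (s' - s) * p' * (p + 1) by rewrite !mulr_ge0 ?subr_ge0 ?(ltW p1) ?(ltW ss').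
  split=> [|p'0].
    by rewrite ler_pdivrMr // mulrAC ler_pdivlMr // -subr_ge0 E addr_ge0.
  rewrite ltr_pdivrMr // mulrAC ltr_pdivlMr // -subr_gt0 E ltr_wpDl //.
  by rewrite !mulr_gt0 ?subr_gt0.
elim: m => [|m [IH IH']].
  split => //=; rewrite !mulr0 !addr0 !add0r !divr1 !mulr1.
  by rewrite ltr_pM2l // ltf_pV2 ?posrE ?ltrD2l // ltr_wpDr // ltW.
split; first by apply: (step _ _ _ IH).1; rewrite rho_ge0 // ltW.
apply: (step _ _ _ (ltW IH')).2; first by rewrite rho_ge0 // ltW.
by rewrite rho_gt0 // ltW.
Qed.

(* With x = 2 - cosh theta and s = tanh(theta/2)^2 one has
   rho n s = tanh(n theta/2) / tanh(theta/2). *)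
Lemma F_rho n s : 0 <= s < 1 ->
  F n ((1 - 3 * s) / (1 - s)) =
  (1 - 4 * s * rho n s + s * rho n s ^+ 2) / (1 - s * rho n s ^+ 2).
Proof.
move=> s01; have [s0 s1] := andP s01.
have s1' : 1 - s != 0 by rewrite subr_eq0 gt_eqF.
pose Q p := (1 - 4 * s * p + s * p ^+ 2) / (1 - s * p ^+ 2).
suff [] : F n ((1 - 3 * s) / (1 - s)) = Q (rho n s) /\
          F n.+1 ((1 - 3 * s) / (1 - s)) = Q (rho n.+1 s) by [].
elim: n => [|n [IH1 IH2]].
  split; first by rewrite /Q /= expr0n !mulr0 !subr0 addr0 divr1.
  rewrite /Q /= mulr0 addr0 add0r divr1 expr1n !mulr1; congr (_ / _); ring.
split=> //.
rewrite -[LHS]/(2 * (2 - _) * F n.+1 _ - F n _) IH1 IH2 /Q.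
have hn := rho_sqr_lt1 n s s01; have hn2 := rho_sqr_lt1 n.+2 s s01.
have hn1 := rho_sqr_lt1 n.+1 s s01.
have r0 := rho_ge0 n s s0; have r1 := rho_ge0 n.+1 s s0.
move: hn hn1 hn2 r0 r1 => /=; set p := rho n s => hn hn1 hn2 r0 r1.
have d0 : 1 + s * p != 0 by rewrite gt_eqF // ltr_wpDr ?mulr_ge0.
have d1 : 1 + s * ((p + 1) / (1 + s * p)) != 0.
  by rewrite gt_eqF // (ltr_wpDr (mulr_ge0 s0 r1)).
have e0 : 1 - s * p ^+ 2 != 0 by rewrite gt_eqF ?subr_gt0.
have d2 : 1 + s * p + s * (p + 1) != 0.
  by rewrite gt_eqF // -addrA ltr_wpDr ?addr_ge0 ?mulr_ge0 ?addr_ge0.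
have e1 : (1 + s * p) ^+ 2 - s * (p + 1) ^+ 2 != 0.
  have -> : (1 + s * p) ^+ 2 - s * (p + 1) ^+ 2 = (1 - s) * (1 - s * p ^+ 2).
    by ring.
  by rewrite mulf_neq0.
have e2 : (1 + s * p + s * (p + 1)) ^+ 2 - s * (p + 1 + (1 + s * p)) ^+ 2 != 0.
  have -> : (1 + s * p + s * (p + 1)) ^+ 2 - s * (p + 1 + (1 + s * p)) ^+ 2
    = (1 - s) ^+ 2 * (1 - s * p ^+ 2) by ring.
  by rewrite mulf_neq0 // expf_neq0.
have -> : ((p + 1) / (1 + s * p) + 1) / (1 + s * ((p + 1) / (1 + s * p)))
   = (p + 1 + (1 + s * p)) / (1 + s * p + s * (p + 1)).
  by field; rewrite d0 d2.
have E1 : 1 - s * ((p + 1) / (1 + s * p)) ^+ 2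
  = (1 - s) * (1 - s * p ^+ 2) / (1 + s * p) ^+ 2 by field.
have E2 : 1 - s * ((p + 1 + (1 + s * p)) / (1 + s * p + s * (p + 1))) ^+ 2
  = (1 - s) ^+ 2 * (1 - s * p ^+ 2) / (1 + s * p + s * (p + 1)) ^+ 2 by field.
rewrite E1 E2; field.
by rewrite ?s1' ?d0 ?d2 ?e0.
Qed.

(** Equating the numerator and the denominator of [F_rho] leaves s p (p - 2) = 0 for p = rho n s,
    with s and p positive. *)
Lemma F_eq1 n s : (0 < n)%N -> 0 < s < 1 ->
  F n ((1 - 3 * s) / (1 - s)) = 1 <-> rho n s = 2.
Proof.
move=> n0 /andP[s0 s1]; have s01 : 0 <= s < 1 by rewrite ltW.
rewrite F_rho //; have := rho_sqr_lt1 n s s01; have := rho_gt0 n s (ltW s0) n0.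
move: (rho n s) => p p0 h.
have d : 1 - s * p ^+ 2 != 0 by rewrite gt_eqF ?subr_gt0.
split=> [E|pE]; last first.
  rewrite (_ : 1 - 4 * s * p + s * p ^+ 2 = 1 - s * p ^+ 2) ?divff //.
  by rewrite pE; ring.
have := congr1 (fun z => z * (1 - s * p ^+ 2)) E; rewrite divfK // mul1r => {}E.
have : s * p * (p - 2) = 0 by nra.
move/eqP; rewrite mulf_eq0 mulf_eq0 (gt_eqF s0) (gt_eqF p0) /= subr_eq0.
by move/eqP.
Qed.

(** With p = rho i s < 2 the numerator of [F_rho] is 1 - 4 s + s (2 - p)^2, where 4 s = s (rho k
    s)^2 < 1; it falls short of the denominator by 2 s p (2 - p). *)
Lemma F_rho_bounds i k s : (0 < i < k)%N -> 0 < s < 1 -> rho k s = 2 ->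
  0 < F i ((1 - 3 * s) / (1 - s)) < 1.
Proof.
move=> /andP[i0 ik] /andP[s0 s1] E; have s01 : 0 <= s < 1 by rewrite ltW.
rewrite F_rho //; have := rho_sqr_lt1 i s s01; have := rho_gt0 i s (ltW s0) i0.
have := ltr_rho i k s s01 ik; rewrite E.
have := rho_sqr_lt1 k s s01; rewrite E.
move: (rho i s) => p h4 p2 p0 h.
have d : 0 < 1 - s * p ^+ 2 by rewrite subr_gt0.
have h' : 0 < s * p * (2 - p) by rewrite !mulr_gt0 ?subr_gt0.
rewrite ltr_pdivrMr // divr_gt0 //=; first by nra.
have -> : 1 - 4 * s * p + s * p ^+ 2 = 1 - s * 2 ^+ 2 + s * (2 - p) ^+ 2.
  by ring.
by rewrite ltr_wpDr ?subr_gt0 // mulr_ge0 ?sqr_ge0 ?(ltW s0).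
Qed.

(** Undoing one step from [rho k.+1 s = 2] gives rho k s = 1 / (1 - 2 s), and [F_rho] then evaluates
    to the argument itself. This is the seed of the symmetry [F_sym]. *)
Lemma F_rho_pred k s : 0 < s < 1 -> rho k.+1 s = 2 ->
  F k ((1 - 3 * s) / (1 - s)) = (1 - 3 * s) / (1 - s).
Proof.
move=> /andP[s0 s1] E; have s01 : 0 <= s < 1 by rewrite ltW.
rewrite F_rho //; have := rho_ge0 k s (ltW s0).
have := rho_sqr_lt1 k.+1 s s01; have := rho_sqr_lt1 k s s01; rewrite E.
move: E => /=; move: (rho k s) => p E h1 h2 p0.
have d0 : 1 + s * p != 0 by rewrite gt_eqF // ltr_wpDr // mulr_ge0 // ltW.
have s2 : 1 - 2 * s != 0 by rewrite gt_eqF //; lra.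
have s3 : 1 - s != 0 by rewrite gt_eqF //; lra.
have pE : p = (1 - 2 * s)^-1.
  apply: (mulIf s2); rewrite mulVf //.
  have : p + 1 = 2 * (1 + s * p) by rewrite -E divfK.
  by lra.
have d : 1 - s * p ^+ 2 != 0 by rewrite gt_eqF // subr_gt0.
have s4 : 1 - 4 * s != 0 by rewrite gt_eqF //; lra.
have d' : 1 - s * p ^+ 2 = (1 - s) * (1 - 4 * s) / (1 - 2 * s) ^+ 2.
  by rewrite pE; field.
rewrite d' pE; field.
by rewrite s2 s3 s4.
Qed.

Lemma rho_continuous n s : 0 <= s -> {for s, continuous (rho n)}.
Proof.
move=> s0; elim: n => [|n IH]; first exact: cst_continuous.
apply: (@cvgM _ _ _ _ (fun z => rho n z + 1) (fun z => (1 + z * rho n z)^-1)).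
  by apply: cvgD => //; exact: cvg_cst.
apply: cvgV.
  by rewrite gt_eqF // ltr_wpDr ?mulr_ge0 ?rho_ge0.
by apply: cvgD; [exact: cvg_cst | apply: cvgM].
Qed.

(** At s = 0 the value is k > 2, while at s = 1/4 the bound s rho^2 < 1 forces rho < 2; the
    intermediate value theorem applies in between. *)
Lemma rho_surj k : (3 <= k)%N -> exists2 s, 0 < s < 4^-1 & rho k s = 2.
Proof.
move=> k3; have k1 : (1 < k)%N by apply: leq_trans k3.
have r0 : rho k 0 = k%:R.
  by elim: (k) => //= n ->; rewrite mul0r addr0 divr1 -natr1.
have r4 : rho k 4^-1 < 2.
  have h : 0 <= (4^-1 : R) < 1 by apply/andP; split; lra.
  have := rho_sqr_lt1 k _ h; have := rho_ge0 k 4^-1 (andP h).1; nra.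
have k2 : 2 < k%:R :> R by rewrite ltr_nat.
have [|||s] := @IVT R (rho k) 0 4^-1 2; first by lra.
- apply: continuous_in_subspaceT => s; rewrite inE /= in_itv /= => /andP[s0 _].
  exact: rho_continuous.
- by rewrite r0 ge_min le_max (ltW r4) (ltW k2) orbT.
rewrite in_itv /= => /andP[s0 s4] E; exists s => //.
rewrite !lt_neqAle s0 s4 !andbT; apply/andP; split; apply/eqP => h.
  by move: k2; rewrite -r0 h E ltxx.
by move: r4; rewrite -h E ltxx.
Qed.

(** The substitution is inverted by s = (1 - y) / (3 - y), and s < 1/4 because 4 s = s (rho k s)^2 <
    1. The last equation writes the drift as s / (1 - s), which increases with s. *)
Lemma root_param k y : (0 < k)%N -> 0 < y < 1 -> F k y = 1 ->
  exists s, [/\ 0 < s < 4^-1, rho k s = 2, y = (1 - 3 * s) / (1 - s) &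
    (1 - y) / 2 = s / (1 - s)].
Proof.
move=> k0 /andP[y0 y1] Fy; pose s := (1 - y) / (3 - y).
have d : 0 < 3 - y by lra.
have s0 : 0 < s by rewrite divr_gt0 // subr_gt0.
have s1 : s < 1 by rewrite ltr_pdivrMr //; lra.
have y3 : 3 - y != 0 by rewrite gt_eqF.
have yE : y = (1 - 3 * s) / (1 - s) by rewrite /s; field; rewrite y3 /=; lra.
have E : rho k s = 2 by apply/F_eq1; rewrite ?s0 // -yE.
exists s; split=> //.
  have s01 : 0 <= s < 1 by rewrite ltW.
  have := rho_sqr_lt1 k s s01; rewrite E s0 /=; lra.
by rewrite /s; field; rewrite y3 /=; lra.
Qed.

Lemma root_exists k : (3 <= k)%N -> exists! y, 0 < y < 1 /\ F k y = 1.
Proof.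
move=> k3; have [s /andP[s0 s4] E] := rho_surj _ k3.
have k0 : (0 < k)%N by apply: leq_trans k3.
have k1 : (1 < k)%N by apply: leq_trans k3.
exists ((1 - 3 * s) / (1 - s)); split=> [|y [y01 Fy]].
  split; last by apply/F_eq1 => //; apply/andP; split; lra.
  rewrite ltr_pdivrMr ?divr_gt0 /=; lra.
have [s' [/andP[s'0 s'4] E' -> _]] := root_param _ _ k0 y01 Fy.
have [h|h|-> //] := ltgtP s s'.
  have : rho k s' < rho k s by apply: rho_decr => //; lra.
  by rewrite E E' ltxx.
have : rho k s < rho k s' by apply: rho_decr => //; lra.
by rewrite E E' ltxx.
Qed.

(** It suffices that the parameters satisfy s < t. If t <= s, then rho l t >= rho l s > rho k s = 2,
    against rho l t = 2. *)
Lemma root_gamma_incr k l y z : (3 <= k)%N -> (k < l)%N ->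
  0 < y < 1 -> F k y = 1 -> 0 < z < 1 -> F l z = 1 ->
  (1 - y) / 2 < (1 - z) / 2.
Proof.
move=> k3 kl y01 Fy z01 Fz; have k0 : (0 < k)%N by apply: leq_trans k3.
have l1 : (1 < l)%N by lia.
have [s [/andP[s0 s4] Es _ ->]] := root_param _ _ k0 y01 Fy.
have [t [/andP[t0 t4] Et _ ->]] := root_param _ _ (ltn_trans k0 kl) z01 Fz.
have st : s < t.
  rewrite ltNge; apply/negP; rewrite le_eqVlt => /predU1P[ts|ts].
    have := ltr_rho k l s; rewrite Es -ts Et ltxx => h.
    by suff : false by []; apply: h => //; apply/andP; split; lra.
  have : rho l s < rho l t by apply: rho_decr => //; lra.
  rewrite Et -Es ltNge ltW // ltr_rho //; apply/andP; split; lra.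
rewrite ltr_pdivrMr ?subr_gt0; last by lra.
rewrite mulrAC ltr_pdivlMr ?subr_gt0; lra.
Qed.

(** As long as rho stays at most 2, each step adds at least the constant [e] > 0, which cannot go on
    forever. *)
Lemma rho_gt2 s : 0 <= s < 4^-1 -> exists n0, forall n, (n0 <= n)%N -> 2 < rho n s.
Proof.
move=> /andP[s0 s4]; have s01 : 0 <= s < 1 by apply/andP; split; lra.
suff [n0 h] : exists n, 2 < rho n s.
  exists n0 => n; rewrite leq_eqVlt => /predU1P[<-//|n0n].
  exact: lt_trans h (ltr_rho _ _ _ s01 n0n).
apply: contrapT => /forallNP h.
pose e := (1 - 4 * s) / (1 + 2 * s).
have e0 : 0 < e by rewrite divr_gt0 //; lra.
have lb n : n%:R * e <= rho n s.
  elim: n => [|n IH]; first by rewrite mul0r.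
  rewrite -natr1 mulrDl mul1r; apply: le_trans (lerD IH (lexx _)) _.
  have r2 : rho n s <= 2 by rewrite leNgt; exact/negP/h.
  have r0 := rho_ge0 n s s0; rewrite -lerBrDl /=.
  move: (rho n s) r2 r0 => p p2 p0.
  have d : 0 < 1 + s * p by rewrite ltr_wpDr ?mulr_ge0.
  have -> : (p + 1) / (1 + s * p) - p = (1 - s * p ^+ 2) / (1 + s * p).
    by field; rewrite gt_eqF.
  have sp : s * p <= s * 2 by rewrite ler_wpM2l.
  have sp2 : s * p ^+ 2 <= s * 4 by rewrite ler_wpM2l //; nra.
  rewrite /e ler_pM ?invr_ge0 //; [lra|lra|lra|].
  by rewrite lef_pV2 ?posrE //; lra.
have [n hn] : exists n, 2 / e < n%:R.
  by exists (Num.truncn (2 / e)).+1; rewrite truncnS_gt.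
apply: (h n); apply: lt_le_trans (lb n).
by rewrite -ltr_pdivrMr.
Qed.

Lemma root_gamma_cvg (x : nat -> R) :
  (forall k, (3 <= k)%N -> 0 < x k < 1 /\ F k (x k) = 1) ->
  (1 - x k) / 2 @[k --> \oo] --> (3^-1 : R).
Proof.
move=> hx; apply/cvgrPdist_lt => e e0.
(* The parameter of x_k ends up in (s0, 1/4), and 1/3 - s / (1 - s) = (1 - 4 s) / (3 (1 - s)) is
   below e once 1 - 4 s < e. The maximum with 0 keeps s0 in the domain of [rho_gt2]. *)
pose s0 : R := Num.max 0 (4^-1 - e / 4).
have s04 : 0 <= s0 < 4^-1.
  by rewrite le_max lexx /= gt_max; apply/andP; split; lra.
have [n0 hn0] := rho_gt2 _ s04.
exists (maxn 3 n0) => // k /=; rewrite geq_max => /andP[k3 n0k].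
have [x01 Fx] := hx k k3; have k0 : (0 < k)%N by apply: leq_trans k3.
have k1 : (1 < k)%N by apply: leq_trans k3.
have [s [/andP[sp s4] Es _ ->]] := root_param _ _ k0 x01 Fx.
have [s00 s044] := andP s04.
have s0s : s0 < s.
  rewrite ltNge; apply/negP; rewrite le_eqVlt => /predU1P[ss|ss].
    by have := hn0 k n0k; rewrite -ss Es ltxx.
  have : rho k s0 < rho k s by apply: rho_decr => //; lra.
  by rewrite Es ltNge ltW ?hn0.
have se : 4^-1 - e / 4 < s by apply: le_lt_trans s0s; rewrite le_max lexx orbT.
have d : 1 - s != 0 by rewrite gt_eqF //; lra.
have -> : 3^-1 - s / (1 - s) = (1 - 4 * s) / (3 * (1 - s)) by field; rewrite d.
rewrite ger0_norm; last by rewrite divr_ge0 //; lra.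
rewrite ltr_pdivrMr; last by lra.
nra.
Qed.

(* Summation by parts against the parabola i (k - i), a solution of
   w (i + 1) + w (i - 1) - 2 w i = - 2. *)
Lemma sum_parabola (f : nat -> R) k n :
  \sum_(0 <= i < n) (i.+1%:R * (k%:R - i.+1%:R)) * (f i.+2 + f i - 2 * f i.+1)
  = n%:R * (k%:R - n%:R) * f n.+1 - n.+1%:R * (k%:R - n.+1%:R) * f n
    - 2 * (\sum_(0 <= i < n) f i.+1) + (k%:R - 1) * f 0.
Proof.
elim: n => [|n IH]; first by rewrite !big_geq //; ring.
rewrite !big_nat_recr //= IH; move: (\sum_(_ <= _ < _) _) => S.
by rewrite -!natr1; ring.
Qed.

Lemma sum_diff2 (f : nat -> R) n :
  \sum_(0 <= i < n) (f i.+2 + f i - 2 * f i.+1)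
  = (f n.+1 - f n) - (f 1%N - f 0).
Proof.
elim: n => [|n IH]; first by rewrite big_geq //; ring.
by rewrite !big_nat_recr //= IH; ring.
Qed.

(** The recurrence makes F an eigenvector of the second difference, so its sums reduce to boundary
    terms by summation by parts. *)
Lemma F_diff2 n y : F n.+2 y + F n y - 2 * F n.+1 y = 2 * (1 - y) * F n.+1 y.
Proof. by rewrite -[F n.+2 y]/(2 * (2 - _) * F n.+1 _ - F n _); ring. Qed.

(** What the walk needs of the root: [root_sum] makes the F_i a distribution on the exponents 1,
    ..., k - 1, and [root_sumw] is the mean of i (k - i) under it. *)
Record root_spec (k : nat) (y : R) : Prop := RootSpec {
  root_Fk : F k y = 1;
  root_Fpred : F k.-1 y = y;
  root_F01 : forall i, (0 < i < k)%N -> 0 < F i y < 1;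
  root_sum : \sum_(0 <= i < k.-1) F i.+1 y = 1;
  root_sumw : \sum_(0 <= i < k.-1) (i.+1%:R * (k%:R - i.+1%:R)) * F i.+1 y
     = (k%:R - 2) / (1 - y) }.

Lemma rootP k y : (3 <= k)%N -> 0 < y < 1 -> F k y = 1 -> root_spec k y.
Proof.
move=> k3 y01 Fk; have k0 : (0 < k)%N by apply: leq_trans k3.
have [s [/andP[s0 s4] Es yE _]] := root_param _ _ k0 y01 Fk.
have s01 : 0 < s < 1 by apply/andP; split; lra.
have Fp : F k.-1 y = y by rewrite yE F_rho_pred ?prednK.
have kE : k = k.-1.+1 by rewrite prednK.
have y1 : 1 - y != 0 by rewrite gt_eqF // subr_gt0; case/andP: y01.
have S1 : \sum_(0 <= i < k.-1) F i.+1 y = 1.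
  (* Multiplied by 2 (1 - y), the sum telescopes to (F_k - F_{k-1}) - (F_1 - F_0) = (1 - y) - (y -
     1). *)
  apply: (@mulfI _ (2 * (1 - y))); first by rewrite mulf_neq0.
  rewrite big_distrr /=; under eq_bigr do rewrite -F_diff2.
  by rewrite (sum_diff2 (fun i => F i y)) Fp -kE Fk /=; ring.
split=> //.
- by move=> i ik; rewrite yE; apply: F_rho_bounds ik s01 Es.
- apply: (@mulfI _ (2 * (1 - y))); first by rewrite mulf_neq0.
  rewrite big_distrr /=; under eq_bigr do rewrite mulrCA -F_diff2.
  rewrite (sum_parabola (fun i => F i y)) S1 Fp -kE Fk /=.
  have -> : k.-1%:R = k%:R - 1 :> R by rewrite [in RHS]kE -natr1 addrK.
  by field.
Qed.

End Roots.

Arguments root_spec {R} k y.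

(** * Right multiplication by a letter *)

Section RightMultiplication.
Variables gT1 gT2 : finGroupType.
Local Notation letter := (gT1 + gT2)%type.
Local Notation G := (free_product gT1 gT2).
Implicit Types (u v z : letter) (p s : seq letter) (g h : G).

Lemma normal_form_rcons p v : normal_form (rcons p v) ->
  normal_form p /\ nontrivial v.
Proof.
rewrite /normal_form all_rcons => /andP[/andP[-> ->]] /=.
rewrite -cats1 => /cat_sorted2[-> _]; by [].
Qed.

Lemma normal_form_rcons2 p v u :
  normal_form (rcons (rcons p v) u) =
  [&& normal_form (rcons p v), nontrivial u & ~~ same_factor v u].
Proof.
rewrite /normal_form !all_rcons; case: p => [|y p] /=.
  by case: (nontrivial u); case: (nontrivial v); rewrite ?andbF ?andbT.
rewrite !rcons_path last_rcons.
case: (nontrivial u); case: (nontrivial v); rewrite ?andbF //=.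
by rewrite andbA.
Qed.

Lemma nf_prod p : normal_form p -> nf (\prod_(u <- p) fp_letter u)%g = p.
Proof. by move=> nfp; rewrite -[p]/(nf (FreeProduct nfp)) -fp_prodE. Qed.

Lemma prod_nf g : (\prod_(u <- nf g) fp_letter u)%g = g.
Proof. by rewrite -fp_prodE. Qed.

Lemma nf_inj : injective (@nf gT1 gT2).
Proof. exact: val_inj. Qed.

Lemma nf1 : nf (1%g : G) = [::]. Proof. by []. Qed.

Lemma letter_mul_Some v u z : letter_mul v u = Some z ->
  same_factor v u /\ same_factor v z.
Proof. by case: v u => [?|?] [?|?] //= [<-]. Qed.

Lemma letter_mul_None v u : letter_mul v u = None -> ~~ same_factor v u.
Proof. by case: v u => [?|?] [?|?]. Qed.

Lemma letter_mul_same_factor p v z : same_factor v z -> nontrivial z ->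
  normal_form (rcons p v) -> normal_form (rcons p z).
Proof.
case/lastP: p => [|p y] vz nz; first by rewrite /normal_form /= nz.
rewrite !normal_form_rcons2 nz => /and3P[-> _ /=].
by case: v z y vz {nz} => [?|?] [?|?] [?|?].
Qed.

Lemma nf_mul_same g p v u z : nf g = rcons p v -> letter_mul v u = Some z ->
  nf (g * fp_letter u)%g = if nontrivial z then rcons p z else p.
Proof.
move=> gE vuz; have nfg := nfP g; rewrite gE in nfg.
have -> : (g * fp_letter u = (\prod_(y <- p) fp_letter y) * fp_letter z)%g.
  by rewrite (fp_letter_mul vuz) -{1}(prod_nf g) gE -cats1 big_cat big_seq1 mulgA.
case: ifP => nz.
  have <- : (\prod_(y <- rcons p z) fp_letter y)%g
           = ((\prod_(y <- p) fp_letter y) * fp_letter z)%g.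
    by rewrite -cats1 big_cat big_seq1.
  apply: nf_prod; apply: letter_mul_same_factor nz nfg.
  exact: (letter_mul_Some _ _ _ vuz).2.
have -> : fp_letter z = 1%g by apply: val_inj; rewrite /= fp_letterE nz.
by rewrite mulg1; apply: nf_prod; case: (normal_form_rcons _ _ nfg).
Qed.

Lemma nf_mul_diff g u : nontrivial u ->
  (forall p v, nf g = rcons p v -> ~~ same_factor v u) ->
  nf (g * fp_letter u)%g = rcons (nf g) u.
Proof.
move=> nu h; have <- : (\prod_(y <- rcons (nf g) u) fp_letter y)%g
           = (g * fp_letter u)%g.
  by rewrite -cats1 big_cat big_seq1 /= prod_nf.
apply: nf_prod; have := nfP g; case/lastP: (nf g) h => [|p v] h.
  by rewrite /normal_form /= nu.
by move=> nfp; rewrite normal_form_rcons2 nfp nu; apply: h erefl.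
Qed.

(** Right multiplication by a letter appends a letter, changes the last one or deletes it; the two
    indices are the normal forms before and after. *)
Variant nf_mul_spec g u : seq letter -> seq letter -> Prop :=
  | NfPush of (forall p v, nf g = rcons p v -> ~~ same_factor v u) :
      nf_mul_spec g u (nf g) (rcons (nf g) u)
  | NfChange p v z of letter_mul v u = Some z & nontrivial z :
      nf_mul_spec g u (rcons p v) (rcons p z)
  | NfPop p v z of letter_mul v u = Some z & ~~ nontrivial z :
      nf_mul_spec g u (rcons p v) p.

Lemma nf_mulP g u : nontrivial u ->
  nf_mul_spec g u (nf g) (nf (g * fp_letter u)%g).
Proof.
move=> nu; case/lastP E: (nf g) => [|p v].
  rewrite nf_mul_diff // => [|p v]; last by rewrite E; case: p.
  by rewrite -E; apply: NfPush => p v; rewrite E; case: p.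
case vu: (letter_mul v u) => [z|].
  rewrite (nf_mul_same _ _ _ _ _ E vu).
  by case: ifP => nz; [exact: NfChange vu nz | apply: NfPop vu _; rewrite nz].
have h p' v' : nf g = rcons p' v' -> ~~ same_factor v' u.
  by rewrite E => /rcons_inj[_ <-]; exact: letter_mul_None.
by rewrite nf_mul_diff // -E; apply: NfPush.
Qed.

Lemma fp_letterV u : ((fp_letter u)^-1 = fp_letter (letter_inv u) :> G)%g.
Proof.
apply: (mulgI (fp_letter u)); rewrite mulgV.
rewrite -(@fp_letter_mul _ _ u (letter_inv u)
            (if u is inl _ then inl 1%g else inr 1%g)).
  by case: u => _; rewrite ?fp_letter_inl1 ?fp_letter_inr1.
by case: u => y /=; rewrite mulgV.
Qed.

Lemma size_mul_letter u p : (size (mul_letter u p) <= (size p).+1)%N.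
Proof.
rewrite /mul_letter; case: ifP => // _; case: p => // v p.
case: (letter_mul u v) => // z; case: ifP => _ //=.
exact: leq_trans (leqnSn _) (leqnSn _).
Qed.

Lemma size_mulg g h : (size (nf (g * h)%g) <= size (nf g) + size (nf h))%N.
Proof.
rewrite -[nf (g * h)%g]/(word_mul (nf g) (nf h)) /word_mul.
elim: (nf g) => //= u p IH; apply: leq_trans (size_mul_letter _ _) _.
by rewrite addSn ltnS.
Qed.

Lemma nth_nf_mul y0 g u j : nontrivial u -> (j.+1 < size (nf g))%N ->
  nth y0 (nf (g * fp_letter u)%g) j = nth y0 (nf g) j.
Proof.
move=> nu; case: nf_mulP => // [_|p v z _ _|p v z _ _].
- by move=> h; rewrite nth_rcons ltnW.
- by rewrite size_rcons ltnS => h; rewrite !nth_rcons h.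
- by rewrite size_rcons ltnS => h; rewrite !nth_rcons h.
Qed.

(* Multiplying by a letter can only enter or leave a cone at its tip. *)
Lemma prefix_nf_mul g u s : nontrivial u -> nf g <> s ->
  nf (g * fp_letter u)%g <> s ->
  prefix s (nf (g * fp_letter u)%g) = prefix s (nf g).
Proof.
have pr p v : rcons p v <> s -> prefix s (rcons p v) = prefix s p.
  move=> ne; apply/idP/idP => [|h]; last first.
    exact: prefix_trans h (prefix_rcons _ _).
  case/prefixP => t; case/lastP: t => [|t y].
    by rewrite cats0 => E; case: ne.
  by rewrite -rcons_cat => /rcons_inj[-> _]; exact: prefix_prefix.
move=> nu; case: nf_mulP => // [_|p v z _ _|p v z _ _].
- by move=> _ /pr.
- by move=> /pr -> /pr ->.
- by move=> /pr ->.
Qed.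

Section Functionals.
Variables (S : Type) (idx : S) (op : Monoid.law idx) (f : letter -> S).
Hypothesis f1 : forall u, ~~ nontrivial u -> f u = idx.
Local Notation Phi g := (\big[op/idx]_(u <- nf g) f u).

(** A neutral value on trivial letters lets one formula cover both the change and the cancellation
    of the last letter. *)
Lemma big_nf_same g p v u z : nf g = rcons p v -> letter_mul v u = Some z ->
  Phi (g * fp_letter u)%g = op (\big[op/idx]_(y <- p) f y) (f z).
Proof.
move=> gE vuz; rewrite (nf_mul_same _ _ _ _ _ gE vuz); case: ifP => nz.
  by rewrite -cats1 big_cat big_seq1.
by rewrite f1 ?nz // Monoid.mulm1.
Qed.

Lemma big_nf_diff g u : nontrivial u ->
  (forall p v, nf g = rcons p v -> ~~ same_factor v u) ->
  Phi (g * fp_letter u)%g = op (Phi g) (f u).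
Proof.
by move=> nu h; rewrite nf_mul_diff // -cats1 big_cat big_seq1.
Qed.

Lemma big_nf_rcons g p v : nf g = rcons p v ->
  Phi g = op (\big[op/idx]_(y <- p) f y) (f v).
Proof. by move=> ->; rewrite -cats1 big_cat big_seq1. Qed.

End Functionals.

End RightMultiplication.

(** * Mean increments of additive and multiplicative functionals *)

Section Functions.
Variables (R : realType) (gT1 gT2 : finGroupType) (a : gT1) (b : gT2).
Local Notation letter := (gT1 + gT2)%type.
Local Notation G := (free_product gT1 gT2).
Implicit Types (u v z : letter) (p s : seq letter) (g h : G).
Hypotheses (a1 : a != 1%g) (b1 : b != 1%g).

Definition gens : seq G :=
  [:: fp_letter (inl a); (fp_letter (inl a))^-1%g;
      fp_letter (inr b); (fp_letter (inr b))^-1%g].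

Lemma gens_letter x : x \in gens -> exists2 u, nontrivial u & x = fp_letter u.
Proof.
rewrite !inE => /or4P[] /eqP ->; rewrite ?fp_letterV.
- by exists (inl a).
- by exists (inl a^-1)%g => //=; rewrite invg_eq1.
- by exists (inr b).
- by exists (inr b^-1)%g => //=; rewrite invg_eq1.
Qed.

Lemma sum_gens (f : G -> R) : \sum_(x <- gens) f x =
   f (fp_letter (inl a)) + f (fp_letter (inl a^-1)%g)
   + (f (fp_letter (inr b)) + f (fp_letter (inr b^-1)%g)).
Proof. by rewrite !big_cons big_nil !fp_letterV addr0 !addrA. Qed.

Section Additive.
Variables (w : letter -> R) (kappa : R).
Hypotheses (w1 : forall u, ~~ nontrivial u -> w u = 0)
  (w_inl : forall z : gT1, z != 1%g ->
     w (inl (z * a)%g) + w (inl (z * a^-1)%g) = 2 * w (inl z) - 2)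
  (w_inr : forall z : gT2, z != 1%g ->
     w (inr (z * b)%g) + w (inr (z * b^-1)%g) = 2 * w (inr z) - 2)
  (w_a : w (inl a) + w (inl a^-1%g) = 2 * kappa)
  (w_b : w (inr b) + w (inr b^-1%g) = 2 * kappa).

Definition weight g : R := \sum_(u <- nf g) w u.

(* An additive functional of the normal form only sees the last letter, and the
   second difference [-2] of [w] makes its mean increment constant off [1]. *)
Lemma weight_gens g : \sum_(x <- gens) (weight (g * x)%g - weight g) =
  if g == 1%g then 4 * kappa else 2 * kappa - 2.
Proof.
have a1' : (a^-1 != 1)%g by rewrite invg_eq1.
have b1' : (b^-1 != 1)%g by rewrite invg_eq1.
rewrite sum_gens; case/lastP E: (nf g) => [|p v].
  have -> : g = 1%g by exact: val_inj.
  rewrite eqxx !mul1g /weight !fp_letterE /= a1 b1 a1' b1' /=.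
  by rewrite !big_seq1 !big_nil !subr0 w_a w_b; ring.
have -> : (g == 1%g) = false.
  by apply/eqP => g1; move: E; rewrite g1 nf1; case: (p).
have nfg := nfP g; rewrite E in nfg; have [_] := normal_form_rcons _ _ _ _ nfg.
case: v E nfg => z E nfg /= z1.
  have D (u : gT2) : nontrivial (inr u : letter) ->
    weight (g * fp_letter (inr u))%g = weight g + w (inr u).
    move=> nu; rewrite /weight big_nf_diff // => p' v'.
    by rewrite E => /rcons_inj[_ <-].
  have S (u : gT1) : weight (g * fp_letter (inl u))%g =
    \sum_(y <- p) w y + w (inl (z * u)%g).
    by rewrite /weight (@big_nf_same _ _ _ _ _ w w1 _ _ _ (inl u) _ E erefl).
  rewrite !D // !S.
  rewrite /weight (big_nf_rcons _ _ _ _ _ _ _ _ _ E) /=.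
  by have := w_inl _ z1; have := w_b; lra.
have D (u : gT1) : nontrivial (inl u : letter) ->
  weight (g * fp_letter (inl u))%g = weight g + w (inl u).
  move=> nu; rewrite /weight big_nf_diff // => p' v'.
  by rewrite E => /rcons_inj[_ <-].
have S (u : gT2) : weight (g * fp_letter (inr u))%g =
  \sum_(y <- p) w y + w (inr (z * u)%g).
  by rewrite /weight (@big_nf_same _ _ _ _ _ w w1 _ _ _ (inr u) _ E erefl).
rewrite !D // !S.
rewrite /weight (big_nf_rcons _ _ _ _ _ _ _ _ _ E) /=.
by have := w_inr _ z1; have := w_a; lra.
Qed.

Lemma weight_step g x (B : R) : (forall u, 0 <= w u <= B) -> x \in gens ->
  `|weight (g * x)%g - weight g| <= B.
Proof.
move=> wB /gens_letter[u nu ->]; rewrite /weight.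
case: nf_mulP => // [_|p v z _ _|p v z _ _].
- rewrite -cats1 big_cat big_seq1 /= addrAC subrr add0r ger0_norm.
    by have /andP[] := wB u.
  by have /andP[] := wB u.
- rewrite -!cats1 !big_cat !big_seq1 /= ler_norml.
  by have /andP[] := wB v; have /andP[] := wB z; lra.
- rewrite -!cats1 !big_cat !big_seq1 /= ler_norml.
  by have /andP[] := wB v; lra.
Qed.

End Additive.

Section Multiplicative.
Variables (q : letter -> R) (x : R).
Hypotheses (q1 : forall u, ~~ nontrivial u -> q u = 1)
  (q_inl : forall z : gT1, z != 1%g ->
     q (inl (z * a)%g) + q (inl (z * a^-1)%g) = 2 * (2 - x) * q (inl z))
  (q_inr : forall z : gT2, z != 1%g ->
     q (inr (z * b)%g) + q (inr (z * b^-1)%g) = 2 * (2 - x) * q (inr z))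
  (q_a : q (inl a) + q (inl a^-1%g) = 2 * x)
  (q_b : q (inr b) + q (inr b^-1%g) = 2 * x).

(** The Green function of the walk in multiplicative form, normalised to 1 at the identity;
    [green_gens] is its harmonicity elsewhere. *)
Definition green g : R := \prod_(u <- nf g) q u.

Lemma green1 : green 1%g = 1. Proof. by rewrite /green big_nil. Qed.

Lemma green_letter u : nontrivial u -> green (fp_letter u) = q u.
Proof. by move=> nu; rewrite /green fp_letterE nu big_seq1. Qed.

(** The two generators from the factor of the last letter contribute 2 (2 - x) times the current
    value and the two others 2 x times it, in total 4. *)
Lemma green_gens g : g != 1%g ->
  \sum_(y <- gens) green (g * y)%g = 4 * green g.
Proof.
have a1' : (a^-1 != 1)%g by rewrite invg_eq1.
have b1' : (b^-1 != 1)%g by rewrite invg_eq1.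
move=> g1; rewrite sum_gens; case/lastP E: (nf g) => [|p v].
  by case/eqP: g1; exact: val_inj.
have nfg := nfP g; rewrite E in nfg; have [_] := normal_form_rcons _ _ _ _ nfg.
case: v E nfg => z E nfg /= z1.
  have D (u : gT2) : nontrivial (inr u : letter) ->
    green (g * fp_letter (inr u))%g = green g * q (inr u).
    move=> nu; rewrite /green big_nf_diff // => p' v'.
    by rewrite E => /rcons_inj[_ <-].
  have S (u : gT1) : green (g * fp_letter (inl u))%g =
    \prod_(y <- p) q y * q (inl (z * u)%g).
    by rewrite /green (@big_nf_same _ _ _ _ _ q q1 _ _ _ (inl u) _ E erefl).
  rewrite !D // !S.
  rewrite /green (big_nf_rcons _ _ _ _ _ _ _ _ _ E) /= -!mulrDr q_b q_inl //.
  ring.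
have D (u : gT1) : nontrivial (inl u : letter) ->
  green (g * fp_letter (inl u))%g = green g * q (inl u).
  move=> nu; rewrite /green big_nf_diff // => p' v'.
  by rewrite E => /rcons_inj[_ <-].
have S (u : gT2) : green (g * fp_letter (inr u))%g =
  \prod_(y <- p) q y * q (inr (z * u)%g).
  by rewrite /green (@big_nf_same _ _ _ _ _ q q1 _ _ _ (inr u) _ E erefl).
rewrite !D // !S.
rewrite /green (big_nf_rcons _ _ _ _ _ _ _ _ _ E) /= -!mulrDr q_a q_inr //.
ring.
Qed.

(* The probability, for the walk started at [h], that the limit word has the
   normal form of [g] as a prefix. *)
Definition cone_prob g h : R :=
  if prefix (nf g) (nf h) then 1 - green (g^-1 * h)%g / 2
  else green (g^-1 * h)%g / 2.

(** Away from g, the element h and its neighbours share one affine expression in [green], since the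
    cone is entered or left only at g, where both branches equal 1/2. At g, two neighbours lie in
    the cone and two outside; the terms 1 - q/2 and q/2 add up to 2 because q has the sum 2 x on the
    generators of either factor. *)
Lemma cone_prob_gens g h : g != 1%g ->
  \sum_(y <- gens) cone_prob g (h * y)%g = 4 * cone_prob g h.
Proof.
move=> g1; have [->{h}|hg] := eqVneq h g.
  case/lastP E: (nf g) => [|p v]; first by case/eqP: g1; exact: val_inj.
  have a1' : (a^-1 != 1)%g by rewrite invg_eq1.
  have b1' : (b^-1 != 1)%g by rewrite invg_eq1.
  rewrite /cone_prob prefix_refl mulVg green1 sum_gens !mulKg.
  have D u : nontrivial u -> ~~ same_factor v u ->
    prefix (nf g) (nf (g * fp_letter u)%g).
    move=> nu vu; rewrite nf_mul_diff // ?prefix_rcons // => p' v'.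
    by rewrite E => /rcons_inj[_ <-].
  (* A letter of the last factor does not lengthen g, so the prefix g could only persist as an
     equality, which would force the letter to be trivial. *)
  have L u : same_factor v u -> nontrivial u ->
      prefix (nf g) (nf (g * fp_letter u)%g) = false.
    move=> svu; case vu: (letter_mul v u) => [z|]; last first.
      by have := letter_mul_None _ _ _ _ vu; rewrite svu.
    move=> nu; apply/negP; rewrite E => h.
    have sgu : (size (nf (g * fp_letter u)%g) <= size (rcons p v))%N.
      rewrite (nf_mul_same _ _ _ _ _ _ _ E vu).
      by case: ifP; rewrite !size_rcons.
    move: h; rewrite prefixE take_oversize // -E => /eqP/nf_inj.
    rewrite -[RHS]mulg1 => /mulgI /(congr1 (@nf gT1 gT2)).
    by rewrite fp_letterE nu.
  rewrite !green_letter //.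
  case: v E D L => z E D L.
    rewrite (D (inr b)) // (D (inr b^-1)%g) // (L (inl a)) // (L (inl a^-1)%g) //.
    by have := q_a; have := q_b; lra.
  rewrite (D (inl a)) // (D (inl a^-1)%g) // (L (inr b)) // (L (inr b^-1)%g) //.
  by have := q_a; have := q_b; lra.
have gh1 : (g^-1 * h != 1)%g by rewrite mulg_eq1 eqg_inv eq_sym.
(* With the cone status of h fixed, every neighbour has the value d + c green / 2, even g itself, as
   1 - 1/2 = 1/2. *)
pose c : R := if prefix (nf g) (nf h) then -1 else 1.
pose d : R := if prefix (nf g) (nf h) then 1 else 0.
have E y : y \in gens -> cone_prob g (h * y)%g = d + c * (green (g^-1 * h * y)%g / 2).
  move=> /gens_letter[u nu ->]; rewrite /cone_prob /d /c -mulgA.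
  have [->|ne] := eqVneq (h * fp_letter u)%g g.
    rewrite mulVg green1 prefix_refl; case: ifP => _; lra.
  rewrite prefix_nf_mul //; [|by move/nf_inj/eqP; apply/negP..].
  by case: ifP => _; ring.
rewrite big_seq; under eq_bigr do rewrite E //.
rewrite -big_seq big_split -big_distrr -big_distrl /= green_gens //.
rewrite /cone_prob !big_cons big_nil /d /c; case: ifP => _; lra.
Qed.

Lemma green_le g (beta : R) : (forall u, nontrivial u -> 0 < q u <= beta) ->
  0 < green g <= beta ^+ size (nf g).
Proof.
move=> hq; rewrite /green; have := nfP g; rewrite /normal_form => /andP[+ _].
elim: (nf g) => [|u p IH] /=; first by rewrite big_nil ltr01 lexx.
move=> /andP[nu /IH /andP[p0 pb]]; have /andP[u0 ub] := hq u nu.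
by rewrite big_cons mulr_gt0 //= exprS ler_pM // ltW.
Qed.

End Multiplicative.
End Functions.

Arguments gens {gT1 gT2} a b.
Arguments weight {R gT1 gT2} w g.
Arguments green {R gT1 gT2} q g.
Arguments cone_prob {R gT1 gT2} q g h.

(** * Martingale averages of discrete sequences *)

Section Discrete.
Variables (d : measure_display) (T : measurableType d) (R : realType)
  (P : probability T R).

Section DiscreteVariable.
Variables (C : countType) (Z : T -> C).
Hypothesis mZ : forall c, measurable (Z @^-1` [set c]).

Lemma measurable_discrete_preimage (A : set C) : measurable (Z @^-1` A).
Proof.
rewrite -[A]image_id -bigcup_imset1 preimage_bigcup bigcup_mkcond.
apply: countable_bigcupT_measurable => // c.
by case: ifP => // _; exact: measurable0.
Qed.

Lemma measurable_discrete_fun d' (T' : measurableType d') (f : C -> T') :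
  measurable_fun [set: T] (f \o Z).
Proof.
move=> _ B _; rewrite setTI comp_preimage.
exact: measurable_discrete_preimage.
Qed.

Lemma integral_discrete (L : seq C) (f : C -> R) :
  uniq L -> {ae P, forall t, Z t \in L} ->
  (\int[P]_t (f (Z t))%:E =
   (\sum_(c <- L) f c * fine (P (Z @^-1` [set c])))%:E)%E.
Proof.
move=> uL aeL.
pose g (t : T) : \bar R :=
  (\sum_(c <- L) ((f c)%:E * (\1_(Z @^-1` [set c]) t)%:E))%E.
have mg : measurable_fun [set: T] g.
  apply: emeasurable_sum => c; apply: emeasurable_funM => //.
  by apply/measurable_EFinP; exact: measurable_indic.
rewrite (@ae_eq_integral _ _ _ P setT g) //.
- rewrite /g integral_sum //; last first.
    move=> c; apply: integrableZl => //; exact: integrable_indic.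
  rewrite -sumEFin; apply: eq_bigr => c _.
  rewrite integralZl //; last exact: integrable_indic.
  by rewrite integral_indic // setIT EFinM fineK // fin_num_measure.
- by apply/measurable_EFinP; exact: measurable_discrete_fun.
- apply: filterS aeL => t tL _; rewrite /g (bigD1_seq (Z t)) //= indicE mem_set //.
  rewrite mule1 big1 ?adde0 // => c cZ.
  rewrite indicE memNset ?mule0 // => /= E; by rewrite E eqxx in cZ.
Qed.

End DiscreteVariable.

(** By monotone convergence the series of the [f n] has integral at most M, so it is finite almost
    everywhere and its terms tend to 0. *)
Lemma ae_cvg0_summable (f : nat -> T -> R) (b : nat -> R) (M : R) :
  (forall n, measurable_fun [set: T] (f n)) -> (forall n t, 0 <= f n t) ->
  (forall n, (\int[P]_t (f n t)%:E <= (b n)%:E)%E) ->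
  (forall n, \sum_(0 <= i < n) b i <= M) ->
  {ae P, forall t, f n t @[n --> \oo] --> (0 : R)}.
Proof.
move=> mf f0 fb bM.
have mF n : measurable_fun [set: T] (fun t => (f n t)%:E).
  exact/measurable_EFinP.
have F0 n t : (0 <= (f n t)%:E)%E by rewrite lee_fin.
pose F t := (\sum_(0 <= n <oo) (f n t)%:E)%E.
have IF : (\int[P]_t F t <= M%:E)%E.
  rewrite integral_nneseries //; apply: lime_le.
    by apply: is_cvg_nneseries => n _ _; apply: integral_ge0.
  apply: nearW => n; apply: le_trans (_ : (\sum_(0 <= i < n) (b i)%:E <= _)%E).
    by apply: lee_sum.
  by rewrite sumEFin lee_fin.
have F_ge0 t : (0 <= F t)%E by apply: nneseries_ge0.
have mFF : measurable_fun [set: T] F by exact: ge0_emeasurable_sum.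
have iF : P.-integrable [set: T] F.
  apply/integrableP; split=> //.
  rewrite (eq_integral F) => [|t _]; last by rewrite gee0_abs.
  exact: le_lt_trans IF (ltry _).
have := integrable_ae measurableT iF; apply: filterS => t /(_ I) Ft.
apply: cvg_series_cvg_0; apply: nondecreasing_is_cvgn.
  by apply: nondecreasing_series => n _ _.
exists (fine (F t)) => _ [n _ <-].
rewrite -lee_fin fineK // /series /= -sumEFin.
exact: nneseries_lim_ge.
Qed.

End Discrete.

(** * Averages and the subsequence of squares *)

Section Averages.
Variable R : realType.

Lemma sum_inv_sqr_le n : \sum_(0 <= i < n) (i.+1%:R ^+ 2)^-1 <= 2 :> R.
Proof.
suff h : \sum_(0 <= i < n.+1) (i.+1%:R ^+ 2)^-1 <= 2 - n.+1%:R^-1 :> R.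
  apply: le_trans (le_trans h _); first by rewrite big_nat_recr //= lerDl invr_ge0.
  by rewrite gerBl invr_ge0.
elim: n => [|n IH]; first by rewrite big_nat1 expr1n invr1; lra.
rewrite big_nat_recr //=; apply: le_trans (lerD IH (lexx _)) _.
rewrite -(natr1 n.+1).
have : 0 < n.+1%:R :> R by [].
move: (n.+1%:R : R) => x x0.
rewrite -addrA lerD2l -subr_ge0.
have -> : - (x + 1)^-1 - (- x^-1 + ((x + 1) ^+ 2)^-1)
  = (x * (x + 1) ^+ 2)^-1.
  by field; rewrite !gt_eqF // addr_gt0.
by rewrite invr_ge0 mulr_ge0 ?sqr_ge0 // ltW.
Qed.

Lemma nat_sqrt n : exists m, (m ^ 2 <= n < m.+1 ^ 2)%N.
Proof.
elim: n => [|n [m /andP[h1 h2]]]; first by exists 0%N.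
have [h|h] := ltnP n.+1 (m.+1 ^ 2); first by exists m; rewrite h leqW.
exists m.+1; rewrite h /=; apply: leq_ltn_trans h2 _.
by rewrite ltn_exp2r.
Qed.

(** Between consecutive squares m^2 <= n < (m + 1)^2 the sequence moves by at most 2 m K, which is
    negligible against n >= m^2. *)
Lemma avg_cvg0_squares (a : nat -> R) (K : R) :
  (forall n, `|a n.+1 - a n| <= K) ->
  a (m.+1 ^ 2)%N / (m.+1 ^ 2)%N%:R @[m --> \oo] --> (0 : R) ->
  a n / n%:R @[n --> \oo] --> (0 : R).
Proof.
move=> aK acvg; have K0 : 0 <= K by apply: le_trans (aK 0%N).
have aD m n : `|a (m + n)%N - a m| <= K * n%:R.
  elim: n => [|n IH]; first by rewrite addn0 subrr normr0 mulr0.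
  rewrite addnS -natr1 mulrDr mulr1 [leRHS]addrC -(subrKA (a (m + n)%N)).
  by rewrite (le_trans (ler_normD _ _)) // lerD.
apply/cvgrPdist_lt => e e0.
move/cvgrPdist_lt: acvg => /(_ (e / 2)) []; first by lra.
move=> N _ hN.
have [M hM] : exists M, 4 * K / e < M%:R.
  by exists (Num.truncn (4 * K / e)).+1; rewrite truncnS_gt.
exists ((maxn N M).+1 ^ 2)%N => // n /= hn.
have [m /andP[m1 m2]] := nat_sqrt n.
have mNM : (maxn N M <= m.-1)%N /\ (0 < m)%N.
  have : ((maxn N M).+1 < m.+1)%N by rewrite -(@ltn_exp2r _ _ 2) //; apply: leq_ltn_trans m2.
  by case: (m).
case: m m1 m2 mNM => [|m] m1 m2 [mNM] //= _.
move: mNM; rewrite geq_max => /andP[Nm Mm].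
have := hN m Nm; rewrite /= !sub0r !normrN => hm.
have n0 : (0 < n)%N by apply: leq_trans m1; rewrite expn_gt0.
rewrite normf_div normr_nat ltr_pdivrMr ?ltr0n //.
rewrite normf_div normr_nat in hm.
rewrite ltr_pdivrMr ?ltr0n ?expn_gt0 // in hm.
have h1 := aD (m.+1 ^ 2)%N (n - m.+1 ^ 2)%N.
rewrite subnKC // in h1.
have h2 : `|a n| <= `|a (m.+1 ^ 2)%N| + K * (n - m.+1 ^ 2)%N%:R.
  rewrite -(subrKC (a (m.+1 ^ 2)%N) (a n)) (le_trans (ler_normD _ _)) //.
  by rewrite lerD2l.
apply: le_lt_trans h2 _.
have h3 : (n - m.+1 ^ 2)%N%:R <= 2 * m.+1%:R :> R.
  rewrite -natrM ler_nat leq_subLR.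
  move: m2; rewrite !expnS !expn0; lia.
have h4 : 4 * K < e * m.+1%:R.
  rewrite [ltRHS]mulrC -ltr_pdivrMr //; apply: lt_trans hM _.
  by rewrite ltr_nat ltnS.
have h5 : (m.+1 ^ 2)%N%:R <= n%:R :> R by rewrite ler_nat.
have h6 : (m.+1 ^ 2)%N%:R = m.+1%:R * m.+1%:R :> R by rewrite natrX expr2.
have m0 : 0 < m.+1%:R :> R by [].
have h7 : K * (n - m.+1 ^ 2)%N%:R <= K * (2 * m.+1%:R) by rewrite ler_wpM2l.
have h8 : e / 2 * (m.+1 ^ 2)%N%:R <= e / 2 * n%:R.
  by rewrite ler_wpM2l // divr_ge0 // ltW.
have h9 : K * (2 * m.+1%:R) < e / 2 * (m.+1 ^ 2)%N%:R.
  by rewrite h6; nra.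
lra.
Qed.

End Averages.

(** * Finite histories of a discrete process and martingales over them *)

Section Traces.
Variables (d : measure_display) (T : measurableType d) (R : realType)
  (P : probability T R) (E : countType) (Y : nat -> T -> E) (S : seq E) (e0 : E).
Hypotheses (mY : forall n e, measurable (Y n @^-1` [set e])) (uS : uniq S)
  (aeS : {ae P, forall t n, Y n t \in S}).

Definition trace n t : seq E := mkseq (Y ^~ t) n.

Arguments trace n t : simpl never.

Definition trace_prob s : R := fine (P (trace (size s) @^-1` [set s])).

Fixpoint words n : seq (seq E) :=
  if n is m.+1 then [seq rcons s e | s <- words m, e <- S] else [:: [::]].

Lemma traceS n t : trace n.+1 t = rcons (trace n t) (Y n t).
Proof. by rewrite /trace mkseqS. Qed.

Lemma size_words n s : s \in words n -> size s = n.
Proof.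
elim: n s => [|n IH] s /=; first by rewrite inE => /eqP ->.
by case/allpairsP => -[s' e] /= [/IH s'n _ ->]; rewrite size_rcons s'n.
Qed.

Lemma words_uniq n : uniq (words n).
Proof.
elim: n => //= n IH; apply: allpairs_uniq => //.
by move=> [s e] [s' e'] _ _ /= /rcons_inj[-> ->].
Qed.

Lemma big_wordsS n (f : seq E -> R) :
  \sum_(s <- words n.+1) f s = \sum_(s <- words n) \sum_(e <- S) f (rcons s e).
Proof. by rewrite big_allpairs_dep. Qed.

Lemma measurable_trace n s : measurable (trace n @^-1` [set s]).
Proof.
elim: n s => [|n IH] s.
  have [->|/eqP ns] := eqVneq s [::].
    by rewrite (_ : _ @^-1` _ = setT) //; apply/seteqP; split.
  rewrite (_ : _ @^-1` _ = set0) //; apply/seteqP; split => // t /= ts.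
  by case: ns; rewrite -ts.
case/lastP: s => [|s e].
  rewrite (_ : _ @^-1` _ = set0) //; apply/seteqP; split => // t.
rewrite (_ : _ @^-1` _ = trace n @^-1` [set s] `&` Y n @^-1` [set e]).
  exact: measurableI.
apply/seteqP; split => t /=; first by rewrite traceS => /rcons_inj[-> ->].
by rewrite traceS => -[-> ->].
Qed.

Lemma trace_words : {ae P, forall t n, trace n t \in words n}.
Proof.
apply: filterS aeS => t tS; elim=> [|n IH] /=; first by rewrite inE.
by rewrite traceS; apply/allpairsP; exists (trace n t, Y n t); rewrite ?IH ?tS.
Qed.

Lemma expectation_trace n (f : seq E -> R) :
  (\int[P]_t (f (trace n t))%:E =
   (\sum_(s <- words n) f s * trace_prob s)%:E)%E.
Proof.
rewrite (@integral_discrete d T R P _ (trace n) (measurable_trace n) (words n)).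
- congr EFin; apply: eq_big_seq => s /size_words sn.
  by rewrite /trace_prob sn.
- exact: words_uniq.
- by apply: filterS trace_words => t; apply.
Qed.

Lemma sum_trace_prob n : \sum_(s <- words n) trace_prob s = 1.
Proof.
apply: EFin_inj; under eq_bigr do rewrite -[trace_prob _]mul1r.
rewrite -(expectation_trace n (fun=> 1)).
rewrite -[LHS]/(\int[P]_t (cst 1 t))%E integral_cst //= mul1e; exact: probability_setT.
Qed.

Lemma trace_prob_ge0 s : 0 <= trace_prob s.
Proof. exact: fine_ge0. Qed.

(** Summing out the last letter turns the law of the histories of length n + 1 into that of length
    n: one expectation is computed twice, f being read on the first n letters. *)
Lemma trace_prob_tower n (f : seq E -> R) :
  \sum_(s <- words n) \sum_(e <- S) f s * trace_prob (rcons s e) =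
  \sum_(s <- words n) f s * trace_prob s.
Proof.
apply: EFin_inj; rewrite -expectation_trace.
have -> : (\int[P]_t (f (trace n t))%:E =
  \int[P]_t ((fun s => f (take n s)) (trace n.+1 t))%:E)%E.
  apply: eq_integral => t _; congr (f _)%:E.
  by rewrite traceS -cats1 take_size_cat // size_mkseq.
rewrite (expectation_trace n.+1 (fun s => f (take n s))) big_wordsS; congr EFin.
apply: eq_big_seq => s /size_words sn; apply: eq_bigr => e _.
by rewrite -cats1 take_size_cat.
Qed.

Section Martingale.
Variables (D : seq E -> E -> R) (K : R).
Hypotheses
  (centered : forall n s, s \in words n ->
     \sum_(e <- S) D s e * trace_prob (rcons s e) = 0)
  (bounded : forall n s e, s \in words n -> e \in S -> `|D s e| <= K).

(** The martingale at time [size s] as a function of the history. In [centered], the vanishing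
    conditional mean of the increment appears multiplied by the probability of the history. *)
Let A s := \sum_(0 <= i < size s) D (take i s) (nth e0 s i).

Let A_rcons s e : A (rcons s e) = A s + D s e.
Proof.
rewrite /A size_rcons big_nat_recr //= nth_rcons ltnn eqxx -cats1.
rewrite take_size_cat //; congr (_ + _).
rewrite !big_nat; apply: eq_bigr => i /andP[_ si].
by rewrite cats1 nth_rcons si -cats1 takel_cat // ltnW.
Qed.

Let A_trace n t : A (trace n t) = \sum_(0 <= i < n) D (trace i t) (Y i t).
Proof.
elim: n => [|n IH]; first by rewrite /A !big_geq.
by rewrite traceS A_rcons IH big_nat_recr.
Qed.

(** Increments are orthogonal: the cross term 2 A D vanishes after summation over the last letter,
    and each square adds at most K^2. *)
Lemma second_moment n :
  \sum_(s <- words n) A s ^+ 2 * trace_prob s <= K ^+ 2 * n%:R.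
Proof.
elim: n => [|n IH]; first by rewrite big_seq1 /A big_geq // expr0n mul0r mulr0.
rewrite big_wordsS.
apply: (@le_trans _ _ (\sum_(s <- words n) \sum_(e <- S)
    ((A s ^+ 2 + K ^+ 2) * trace_prob (rcons s e)
     + 2 * A s * (D s e * trace_prob (rcons s e))))).
  rewrite big_seq [leRHS]big_seq; apply: ler_sum => s sn.
  rewrite big_seq [leRHS]big_seq; apply: ler_sum => e eS.
  rewrite A_rcons mulrA -mulrDl ler_wpM2r ?trace_prob_ge0 //.
  have : D s e ^+ 2 <= K ^+ 2.
    rewrite -[D s e ^+ 2]real_normK ?num_real // ler_sqr ?nnegrE ?(bounded n) //.
    exact: le_trans (bounded _ _ _ sn eS).
  nra.
rewrite (eq_big_seq (fun s => \sum_(e <- S)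
    (A s ^+ 2 + K ^+ 2) * trace_prob (rcons s e))) => [|s sn]; last first.
  by rewrite big_split /= -[X in _ + X]big_distrr /= (centered _ _ sn) mulr0 addr0.
rewrite (trace_prob_tower n (fun s => A s ^+ 2 + K ^+ 2)).
under eq_bigr do rewrite mulrDl.
rewrite big_split /= -big_distrr /= sum_trace_prob mulr1 -natr1 mulrDr mulr1.
by rewrite lerD2r.
Qed.

(** At the times (m + 1)^2 the second moment of the average is at most K^2 / (m + 1)^2, which is
    summable; bounded increments fill the gaps between the squares. *)
Lemma martingale_average :
  {ae P, forall t, (\sum_(0 <= i < n) D (trace i t) (Y i t)) / n%:R
     @[n --> \oo] --> (0 : R)}.
Proof.
pose N m := (m.+1 ^ 2)%N.
pose f m t : R := (A (trace (N m) t) / (N m)%:R) ^+ 2.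
have N0 m : 0 < (N m)%:R :> R by rewrite ltr0n expn_gt0.
have H : {ae P, forall t, f m t @[m --> \oo] --> (0 : R)}.
  apply: (@ae_cvg0_summable _ T R P f
    (fun m => K ^+ 2 * (m.+1%:R ^+ 2)^-1) (K ^+ 2 * 2)).
  - move=> m; apply: (@measurable_discrete_fun d T _ _ (measurable_trace (N m)) _
      (R : measurableType _) (fun s => (A s / (N m)%:R) ^+ 2)).
  - by move=> m t; rewrite sqr_ge0.
  - move=> m; rewrite (expectation_trace (N m) (fun s => (A s / (N m)%:R) ^+ 2)).
    rewrite lee_fin.
    under eq_bigr do rewrite expr_div_n mulrAC.
    rewrite -mulr_suml ler_pdivrMr ?exprn_gt0 //.
    apply: le_trans (second_moment _) _.
    suff -> : K ^+ 2 / m.+1%:R ^+ 2 * (N m)%:R ^+ 2 = K ^+ 2 * (N m)%:R by [].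
    by rewrite /N natrX; field.
  - by move=> m; rewrite -big_distrr /= ler_wpM2l ?sqr_ge0 // sum_inv_sqr_le.
near=> t.
have Ht : f m t @[m --> \oo] --> (0 : R) by near: t; exact: H.
have Wt : forall n, trace n t \in words n by near: t; exact: trace_words.
have St : forall n, Y n t \in S by near: t; exact: aeS.
under eq_cvg do rewrite -A_trace.
apply: (@avg_cvg0_squares R (fun n => A (trace n t)) K).
  by move=> n; rewrite traceS A_rcons addrAC subrr add0r (bounded n).
apply/cvgr0Pnorm_lt => e e_gt0.
move/cvgr0Pnorm_lt: Ht => /(_ (e ^+ 2)) []; first by rewrite exprn_gt0.
move=> M _ hM; exists M => // m Mm /=.
have := hM m Mm; rewrite /= normrX ltr_pXn2r ?nnegrE // ltW //.
Unshelve. all: by end_near.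
Qed.

End Martingale.

End Traces.

Arguments trace {d T E} Y n t.
Arguments trace_prob {d T R} P {E} Y s.
Arguments words {E} S n.

(** * Escaping sequences of group elements *)

Section DeterministicWalk.
Variables (R : realType) (gT1 gT2 : finGroupType) (a : gT1) (b : gT2).
Local Notation letter := (gT1 + gT2)%type.
Local Notation G := (free_product gT1 gT2).
Variables (g y : nat -> G).
Hypotheses (a1 : a != 1%g) (b1 : b != 1%g) (g0 : g 0 = 1%g)
  (gS : forall n, g n.+1 = (g n * y n)%g) (yS : forall n, y n \in gens a b).
Local Notation x0 := (inl 1%g : letter).

Definition escapes (h : nat -> G) : Prop :=
  forall N, \forall n \near \oo, (N <= size (nf (h n)))%N.

(** A right multiplication touches only the last letter, and the bound [j.+1 < size] says that
    letter j is not the last. *)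
Lemma nth_stable j n m : (forall l, (n <= l)%N -> (j.+1 < size (nf (g l)))%N) ->
  (n <= m)%N -> nth x0 (nf (g m)) j = nth x0 (nf (g n)) j.
Proof.
move=> h; elim: m => [|m IH]; first by rewrite leqn0 => /eqP->.
rewrite leq_eqVlt => /predU1P[->//|]; rewrite ltnS => nm.
have [u nu yE] := gens_letter _ _ _ _ a1 b1 _ (yS m).
by rewrite gS yE nth_nf_mul ?IH // h.
Qed.

Lemma escapes_converges : escapes g -> exists w, converges_letterwise g w.
Proof.
move=> esc.
have /choice[N hN] : forall j, exists N, forall n, (N <= n)%N ->
    (j.+1 < size (nf (g n)))%N.
  by move=> j; have [N _ hN] := esc j.+2; exists N => n; exact: hN.
exists (fun j => nth x0 (nf (g (N j))) j) => j; exists (N j) => // n /= nN.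
split; first by apply: ltn_trans (hN j n nN).
by apply: nth_stable => // l; exact: hN.
Qed.

Section Limit.
Variables (h : nat -> G) (w : infinite_word gT1 gT2).
Hypothesis cvg_h : converges_letterwise h w.

Lemma converges_escapes : escapes h.
Proof.
move=> N; have [M _ hM] := cvg_h N; exists M => // n /hM[+ _].
exact: ltnW.
Qed.

Lemma converges_take m : \forall n \near \oo, take m (nf (h n)) = mkseq w m.
Proof.
elim: m => [|m IH]; first by apply: nearW => n; rewrite take0.
near=> n.
have [sm nm] : (m < size (h n))%N /\ nth x0 (h n) m = w m.
  by near: n; exact: cvg_h.
have E : take m (nf (h n)) = mkseq w m by near: n; exact: IH.
by rewrite (take_nth x0) // E nm mkseqS.
Unshelve. all: by end_near. Qed.

Lemma converges_prefix s :
  \forall n \near \oo, prefix s (nf (h n)) = (mkseq w (size s) == s).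
Proof.
by apply: filterS (converges_take (size s)) => n; rewrite prefixE => ->.
Qed.

Lemma converges_normal : infinite_normal_form w.
Proof.
move=> j; have [N _ hN] := converges_take j.+2.
have := hN N (leqnn _); have := nfP (h N).
set s := nf (h N) => nfs sE.
have : normal_form (take j.+2 s).
  move: nfs; rewrite /normal_form => /andP[n1 n2]; apply/andP; split.
    by apply/allP => u /mem_take; exact: (allP n1).
  by rewrite take_sorted.
rewrite sE !mkseqS normal_form_rcons2 => /and3P[+ _ ->].
by move=> /normal_form_rcons[_ ->].
Qed.

End Limit.

Section Weights.
Variables (w : letter -> R) (kappa B : R).
Hypotheses (wB : forall u, 0 <= w u <= B) (w1 : forall u, nontrivial u -> 1 <= w u)
  (kappa1 : 1 < kappa).
Local Notation wt := (weight w).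

Let B1 : 1 <= B.
Proof.
have : nontrivial (inl a : letter) by [].
by move=> /w1 h; have /andP[_] := wB (inl a); exact: le_trans.
Qed.

Lemma weight_le h : wt h <= B * (size (nf h))%:R.
Proof.
rewrite /weight; elim: (nf h) => [|u p IH]; first by rewrite big_nil mulr0.
rewrite big_cons /= -natr1 mulrDr mulr1 addrC lerD //.
by have /andP[] := wB u.
Qed.

(** A quarter of the sum in [weight_gens], that is, the conditional mean of the weight increment;
    [err] below is the compensated weight. *)
Definition mean_step (h : G) : R := if h == 1%g then kappa else (kappa - 1) / 2.

Let err n := \sum_(0 <= i < n) (wt (g i * y i)%g - wt (g i) - mean_step (g i)).

Let errE n : err n = wt (g n) - \sum_(0 <= i < n) mean_step (g i).
Proof.
elim: n => [|n IH].
  by rewrite /err !big_geq // g0 /weight big_nil subrr.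
by rewrite /err !big_nat_recr //= -/(err n) IH gS; ring.
Qed.

Let mean_step_ge h : (kappa - 1) / 2 <= mean_step h.
Proof. by rewrite /mean_step; case: ifP => _; have := kappa1; lra. Qed.

(** The compensator is at least c n and the error is o(n); as a letter weighs at most B, the number
    of letters tends to infinity. *)
Lemma weight_escapes : err n / n%:R @[n --> \oo] --> (0 : R) -> escapes g.
Proof.
move=> /cvgr0Pnorm_lt err0 N; set c := (kappa - 1) / 2.
have c0 : 0 < c by rewrite /c; have := kappa1; lra.
have [M hM] : exists M, 2 * B * N%:R / c < M%:R.
  by exists (Num.truncn (2 * B * N%:R / c)).+1; rewrite truncnS_gt.
have [K _ hK] : \forall n \near \oo, `|err n / n%:R| < c / 2.
  by apply: err0; rewrite divr_gt0.
exists (maxn M.+1 K) => // n /=; rewrite geq_max => /andP[Mn Kn].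
have n0 : 0 < n%:R :> R by rewrite ltr0n; apply: leq_trans Mn.
have := hK n Kn; rewrite /= normf_div normr_nat ltr_pdivrMr //.
rewrite ltr_norml => /andP[+ _]; rewrite errE.
have : c * n%:R <= \sum_(0 <= i < n) mean_step (g i).
  rewrite mulr_natr -[X in _ *+ X]subn0 -sumr_const_nat.
  by apply: ler_sum => i _; exact: mean_step_ge.
have := weight_le (g n).
rewrite ltr_pdivrMr // in hM.
have Mn' : M%:R * c <= n%:R * c by rewrite ler_wpM2r ?ler_nat ?(ltnW Mn) // ltW.
move=> h1 h2 h3.
have : B * N%:R < B * (size (nf (g n)))%:R by lra.
rewrite ltr_pM2l; last by apply: lt_le_trans B1.
by rewrite ltr_nat; exact: ltnW.
Qed.

(** After the last visit to the identity every mean step equals c, so the compensator is c n plus a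
    constant. *)
Lemma weight_speed : err n / n%:R @[n --> \oo] --> (0 : R) ->
  wt (g n) / n%:R @[n --> \oo] --> (kappa - 1) / 2.
Proof.
move=> err0; set c := (kappa - 1) / 2.
have [N _ hN] := weight_escapes err0 1%N.
pose r n := \sum_(0 <= i < n) mean_step (g i) - c * n%:R.
have rN n : (N <= n)%N -> r n = r N.
  elim: n => [|n IH]; first by rewrite leqn0 => /eqP ->.
  rewrite leq_eqVlt => /predU1P[<-//|]; rewrite ltnS => Nn.
  rewrite -IH // /r big_nat_recr //= /mean_step; case: eqP => [g1|_].
    by have := hN n Nn; rewrite /= g1.
  by rewrite -natr1 -/c; ring.
have cvg_inv : (n%:R^-1 : R) @[n --> \oo] --> (0 : R).
  by rewrite -cvg_shiftS; exact: cvg_harmonic.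
suff : err n / n%:R + c + r N / n%:R @[n --> \oo] --> 0 + c + r N * 0.
  rewrite mulr0 add0r addr0; apply: cvg_trans; apply: near_eq_cvg.
  exists (maxn N 1) => // n /=; rewrite geq_max => /andP[Nn n0].
  rewrite -(rN n Nn) errE /r; field.
  by rewrite pnatr_eq0 -lt0n.
apply: cvgD; first by apply: cvgD => //; exact: cvg_cst.
by apply: cvgM => //; exact: cvg_cst.
Qed.

(* The weight of the part of [g n] that is final from time [n] on differs by
   [o(n)] from the weight of [g n] itself, so both have asymptotically the same
   number of letters. *)
Lemma size_speed (l : infinite_word gT1 gT2) (c mean : R) : 0 < c -> 0 < mean ->
  converges_letterwise g l ->
  wt (g n) / n%:R @[n --> \oo] --> c ->
  (\sum_(0 <= j < m) w (l j)) / m%:R @[m --> \oo] --> mean ->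
  (size (nf (g n)))%:R / n%:R @[n --> \oo] --> c / mean.
Proof.
move=> c0 mean0 cvg_l speed avg; have esc := converges_escapes _ _ cvg_l.
pose A m := \sum_(0 <= j < m) w (l j).
have A0 m : 0 <= A m by apply: sumr_ge0 => j _; have /andP[] := wB (l j).
have AB m : A m <= B * m%:R.
  rewrite mulr_natr -[X in _ *+ X]subn0 -sumr_const_nat.
  by apply: ler_sum => j _; have /andP[] := wB (l j).
have B0 : 0 < B by apply: lt_le_trans B1.
have split_wt n m : (m <= size (nf (g n)))%N -> take m (nf (g n)) = mkseq l m ->
    wt (g n) = A m + \sum_(u <- drop m (nf (g n))) w u.
  move=> mn tE; rewrite /weight -[X in \sum_(u <- X) _](cat_take_drop m) big_cat.
  by rewrite /= tE /mkseq big_map /A /index_iota subn0.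
(* Here m is the predecessor of the minimal length from time n on, so the first m letters are
   already final. The letters after them weigh at least 1 each, and at a time n' attaining the
   minimum at most one letter follows them, of weight at most B. *)
have /choice[m hm] : forall n, exists m,
    ((size (nf (g n)))%:R - m%:R + A m <= wt (g n) /\ (m <= size (nf (g n)))%N)
    /\ exists2 n', (n <= n')%N & wt (g n') <= A m + B.
  move=> n.
  pose Q v := `[< exists2 n', (n <= n')%N & size (nf (g n')) = v >].
  have exQ : exists v, Q v.
    by exists (size (nf (g n))); apply/asboolP; exists n.
  have [M /asboolP[n' nn' sM] Mmin] := ex_minnP exQ.
  have Mle i : (n <= i)%N -> (M <= size (nf (g i)))%N.
    by move=> ni; apply: Mmin; apply/asboolP; exists i.
  have tE i : (n <= i)%N -> take M.-1 (nf (g i)) = mkseq l M.-1.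
    move=> ni; apply: (@eq_from_nth _ x0).
      by rewrite size_mkseq size_takel // (leq_trans (leq_pred _)) ?Mle.
    rewrite size_takel ?(leq_trans (leq_pred _)) ?Mle // => j jM.
    rewrite nth_take // nth_mkseq //.
    have [N _ hN] := cvg_l j; have [_ <-] := hN (maxn N i) (leq_maxl _ _).
    apply/esym/nth_stable; last exact: leq_maxr.
    move=> k ik; apply: leq_trans (Mle k (leq_trans ni ik)).
    by case: (M) jM.
  have Mi i : (n <= i)%N -> (M.-1 <= size (nf (g i)))%N.
    by move=> ni; rewrite (leq_trans (leq_pred _)) ?Mle.
  exists M.-1; split; last first.
    exists n' => //; rewrite (split_wt n' M.-1) ?tE ?Mi // lerD2l.
    have : (size (drop M.-1 (nf (g n'))) <= 1)%N.
      by rewrite size_drop sM; case: (M) => // ?; rewrite /= subSnn.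
    case: (drop _ _) => [|u [|//]] _; first by rewrite big_nil ltW.
    by rewrite big_seq1; have /andP[] := wB u.
  split; last exact: Mi.
  rewrite (split_wt n M.-1) ?tE ?Mi // addrC lerD2l -natrB ?Mi //.
  have := nfP (g n); rewrite /normal_form => /andP[+ _].
  rewrite -[X in all _ X](cat_take_drop M.-1) all_cat => /andP[_ +].
  rewrite -size_drop; elim: (drop _ _) => [|u p IH] /=; first by rewrite big_nil.
  by move=> /andP[nu /IH h]; rewrite big_cons -natr1 addrC lerD // w1.
have Aspeed : A (m n) / n%:R @[n --> \oo] --> c.
  apply/cvgrPdist_lt => e e0.
  (* The bound e' <= c keeps c - e' nonnegative, so the lower bound at n' >= n carries over to n;
     the other half of e absorbs B. *)
  pose e' := Num.min (e / 2) c.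
  have e'0 : 0 < e' by rewrite lt_min c0 divr_gt0.
  have e'e : e' <= e / 2 by rewrite ge_min lexx.
  have e'c : e' <= c by rewrite ge_min lexx orbT.
  move/cvgrPdist_lt: speed => /(_ e' e'0)[N _ hN].
  have [M hM] : exists M, 2 * B / e < M%:R.
    by exists (Num.truncn (2 * B / e)).+1; rewrite truncnS_gt.
  rewrite ltr_pdivrMr // in hM.
  exists (maxn N M.+1) => // n /=; rewrite geq_max => /andP[Nn Mn].
  have dist k : (N <= k)%N -> (0 < k)%N ->
      (c - e') * k%:R <= wt (g k) <= (c + e') * k%:R.
    move=> Nk k0; have := hN k Nk; rewrite /= distrC ltr_distl.
    rewrite ltr_pdivlMr ?ltr0n // ltr_pdivrMr ?ltr0n // => /andP[h1 h2].
    by rewrite !ltW.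
  have n0 : (0 < n)%N by apply: leq_trans Mn.
  have nR : 0 < n%:R :> R by rewrite ltr0n.
  have [[h1 h2] [n' nn' h3]] := hm n.
  have /andP[h4 _] := dist n' (leq_trans Nn nn') (leq_trans n0 nn').
  have /andP[_ h5] := dist n Nn n0.
  have h6 : (c - e') * n%:R <= (c - e') * n'%:R.
    by rewrite ler_wpM2l ?subr_ge0 ?ler_nat.
  have h7 : 0 <= (size (nf (g n)))%:R - (m n)%:R :> R by rewrite subr_ge0 ler_nat.
  have h8 : M%:R * e <= n%:R * e by rewrite ler_wpM2r ?ler_nat ?(ltnW Mn) // ltW.
  have h9 : e' * n%:R <= e / 2 * n%:R by rewrite ler_wpM2r // ltW.
  rewrite distrC ltr_distl ltr_pdivlMr // ltr_pdivrMr //.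
  by apply/andP; split; lra.
have m_infty : (m n : nat) @[n --> \oo] --> \oo.
  apply/cvgnyPge => N.
  move/cvgrPdist_lt: Aspeed => /(_ (c / 2)) []; first by rewrite divr_gt0.
  move=> M _ hM.
  have [K hK] : exists K, 2 * B * N%:R / c < K%:R.
    by exists (Num.truncn (2 * B * N%:R / c)).+1; rewrite truncnS_gt.
  rewrite ltr_pdivrMr // in hK.
  exists (maxn M K.+1) => // n /=; rewrite geq_max => /andP[Mn Kn].
  have nR : 0 < n%:R :> R by rewrite ltr0n; apply: leq_trans Kn.
  have := hM n Mn; rewrite /= distrC ltr_distl ltr_pdivlMr // => /andP[h1 _].
  have h2 := AB (m n).
  have h3 : K%:R * c <= n%:R * c by rewrite ler_wpM2r ?ler_nat ?(ltnW Kn) // ltW.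
  have : B * N%:R < B * (m n)%:R by lra.
  by rewrite ltr_pM2l // ltr_nat => /ltnW.
have avgm : A (m n) / (m n)%:R @[n --> \oo] --> mean.
  exact: (cvg_comp _ _ m_infty avg).
have mspeed : (m n)%:R / n%:R @[n --> \oo] --> c / mean.
  have : (A (m n) / n%:R) / (A (m n) / (m n)%:R) @[n --> \oo] --> c / mean.
    by apply: cvgM => //; apply: cvgV => //; rewrite gt_eqF.
  apply: cvg_trans; apply: near_eq_cvg; near=> n.
  have n0 : n%:R != 0 :> R by rewrite pnatr_eq0 -lt0n; near: n; exact: nbhs_infty_gt.
  have m0 : (0 < m n)%N.
    by near: n; move/cvgnyPge : m_infty => /(_ 1%N).
  have An : 0 < A (m n) / (m n)%:R by near: n; exact: (cvgr_gt mean avgm).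
  have mR : (m n)%:R != 0 :> R by rewrite pnatr_eq0 -lt0n.
  have AA : A (m n) != 0 by apply: contraTneq An => ->; rewrite mul0r ltxx.
  by field; rewrite n0 mR AA.
(* The length lies between m and m + wt - A, and the last two terms cancel in the limit. *)
have up : (m n)%:R / n%:R + (wt (g n) / n%:R - A (m n) / n%:R) @[n --> \oo]
    --> c / mean.
  rewrite -[X in _ --> X]addr0 -[X in _ + X](subrr c).
  by apply: cvgD => //; apply: cvgB.
apply: (squeeze_cvgr _ mspeed up); apply: nearW => n.
have [[h1 h2] _] := hm n.
rewrite -mulrBl -mulrDl !ler_wpM2r ?invr_ge0 ?ler_nat //=.
lra.
Unshelve. all: by end_near. Qed.

End Weights.
End DeterministicWalk.

Arguments escapes {gT1 gT2} h.
Arguments mean_step {R gT1 gT2} kappa h.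

(** * The random walk on a free product *)

Section ProbabilityFacts.
Variables (d : measure_display) (T : measurableType d) (R : realType)
  (P : probability T R).

Lemma ae_probability1 (A : set T) : measurable A ->
  {ae P, forall t, A t} -> P A = 1%E.
Proof.
move=> mA [N [mN N0 subN]].
have PC0 : (P (~` A) = 0)%E.
  apply/eqP; rewrite -measure_le0 -N0.
  by apply: le_measure; rewrite ?inE //; exact: measurableC.
have := probability_setC P mA; rewrite PC0 -[P A]fineK ?fin_num_measure //.
by rewrite -EFinB => -[/eqP]; rewrite eq_sym subr_eq0 => /eqP <-.
Qed.

Lemma probability1_ae (A : set T) : measurable A -> P A = 1%E ->
  {ae P, forall t, A t}.
Proof.
move=> mA PA; exists (~` A); split=> //; first exact: measurableC.
by rewrite (probability_setC P mA) PA subee.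
Qed.

Lemma probability_null_preimage (A : set T) : measurable A ->
  {ae P, forall t, ~ A t} -> P A = 0%E.
Proof.
move=> mA h; have := ae_probability1 (~` A) (measurableC mA) h.
rewrite (probability_setC P mA) -[P A]fineK ?fin_num_measure // -EFinB => -[].
by move=> /eqP; rewrite -subr_eq0 addrAC subrr add0r oppr_eq0 => /eqP->.
Qed.

Lemma measure_seq (C : choiceType) (L : seq C) (f : C -> set T) :
  uniq L -> (forall c, measurable (f c)) -> (forall c c' t, f c t -> f c' t -> c = c') ->
  P (\bigcup_(c in [set` L]) f c) = (\sum_(c <- L) P (f c))%E.
Proof.
move=> + mf finj; elim: L => [|c L IH] /=.
  by rewrite big_nil => _; rewrite (_ : [set` [::]] = set0) ?bigcup_set0 ?measure0 //;
    apply/seteqP; split.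
move=> /andP[cL uL]; rewrite big_cons -IH // (_ : [set` c :: L] = c |` [set` L]).
  rewrite bigcup_setU1 measureU //.
    by rewrite bigcup_seq; apply: bigsetU_measurable.
  apply/seteqP; split => // t [ct [c' c'L c't]].
  by move: cL; rewrite (finj _ _ _ ct c't) c'L.
by apply/seteqP; split => z /=; rewrite inE => /predU1P.
Qed.

End ProbabilityFacts.

(** * Measurability in the space of infinite words *)

Section InfiniteWordMeasurability.
Variables gT1 gT2 : finGroupType.
Local Notation letter := (gT1 + gT2)%type.
Local Notation IW := (infinite_word gT1 gT2).

Lemma measurable_letter n (u : letter) : measurable [set w : IW | w n = u].
Proof. by apply: sub_sigma_algebra; exists n, u. Qed.

Lemma measurable_cylinder (s : seq letter) : measurable (@cylinder gT1 gT2 s).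
Proof.
apply: (@measurable_trace _ IW _ (fun n (w : IW) => w n)).
by move=> n u; exact: measurable_letter.
Qed.

Lemma measurable_normal_words : measurable (@infinite_normal_form gT1 gT2).
Proof.
rewrite (_ : @infinite_normal_form gT1 gT2 = \bigcap_j
   ((fun w : IW => (w j, w j.+1)) @^-1`
      [set uv | nontrivial uv.1 /\ ~~ same_factor uv.1 uv.2])).
  apply: bigcap_measurable => // j _.
  apply: measurable_discrete_preimage => -[u v].
  rewrite (_ : _ @^-1` _ = [set w : IW | w j = u] `&` [set w : IW | w j.+1 = v]).
    by apply: measurableI; exact: measurable_letter.
  by apply/seteqP; split => w /=; [case=> -> -> | case=> -> ->].
by apply/seteqP; split => w h j; [move=> _; exact: h | exact: h].
Qed.

Lemma measurable_to_words d (T : measurableType d) (X : T -> IW) :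
  (forall j u, measurable [set t | X t j = u]) -> measurable_fun [set: T] X.
Proof.
move=> mX.
pose gen : set (set IW) := [set A | exists n u, A = [set w | w n = u]].
apply: (measurability gen) => //.
by move=> B [A [n [u ->]] <-]; rewrite setTI; exact: mX.
Qed.

End InfiniteWordMeasurability.

(** * The law of the walk, its limit word and its drift *)

Section RandomWalk.
Variables (R : realType) (gT1 gT2 : finGroupType) (a : gT1) (b : gT2).
Local Notation letter := (gT1 + gT2)%type.
Local Notation G := (free_product gT1 gT2).
Local Notation IW := (infinite_word gT1 gT2).
Local Notation gens := (gens a b).
Variables (mu : probability G R) (d : measure_display) (T : measurableType d)
  (P : probability T R) (x : nat -> {RV P >-> G}).
Hypotheses (a1 : a != 1%g) (b1 : b != 1%g) (ugens : uniq gens)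
  (mu_gens : forall g, g \in gens -> mu [set g] = (4^-1)%:E) (iid_x : iid mu x).
Local Notation Y := (fun n t => x n t).
Local Notation X := (walk x).
Local Notation tp := (trace_prob P Y).

Let mY n (A : set G) : measurable (x n @^-1` A).
Proof. by rewrite -[_ @^-1` _]setTI; apply: measurable_funPT. Qed.

Let step_dist n A : P (x n @^-1` A) = mu A.
Proof. exact: iid_x.1. Qed.

(** The four atoms are distinct and have mass 1/4 each, so they exhaust [mu]. *)
Lemma steps_gens : {ae P, forall t n, x n t \in gens}.
Proof.
apply: ae_foralln => n; apply: (probability1_ae _ _ _ _ (x n @^-1` [set` gens])) => //.
rewrite step_dist -[[set` _]]image_id -bigcup_imset1 measure_seq //.
  rewrite big_seq; under eq_bigr do rewrite mu_gens //.
  by rewrite -big_seq sumEFin !big_cons big_nil; congr EFin; lra.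
by move=> c c' t /= -> ->.
Qed.

Definition word_prod (s : seq G) : G := (\prod_(h <- s) h)%g.

Lemma word_prod_rcons s e : word_prod (rcons s e) = (word_prod s * e)%g.
Proof. by rewrite /word_prod -cats1 big_cat big_seq1. Qed.

Lemma walk_trace n t : X n t = word_prod (trace Y n t).
Proof.
elim: n => [|n IH]; first by rewrite /word_prod big_nil.
by rewrite traceS word_prod_rcons -IH.
Qed.

Lemma trace_prob_steps s : all (mem gens) s -> tp s = 4^-1 ^+ size s.
Proof.
move=> sg; rewrite /trace_prob.
rewrite (_ : _ @^-1` _ = \bigcap_(i in [set` iota 0 (size s)])
    (x i @^-1` [set nth 1%g s i])).
  rewrite (iid_x.2 (iota 0 (size s)) (fun i => [set nth 1%g s i])) ?iota_uniq //.
  rewrite big_seq (eq_bigr (fun=> (4^-1)%:E)).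
    by rewrite -big_seq prodEFin /= big_const_seq count_predT size_iota iter_mulr_1.
  move=> i; rewrite mem_iota /= => iS.
  by rewrite step_dist mu_gens //; apply: (allP sg); exact: mem_nth.
apply/seteqP; split => t /=.
  move=> ts i; rewrite /= mem_iota add0n /= => iS.
  by rewrite -ts nth_mkseq.
move=> h; apply: (@eq_from_nth _ 1%g); rewrite size_mkseq // => i iS.
by rewrite nth_mkseq //; apply: h; rewrite /= mem_iota.
Qed.

Lemma words_gens n s : s \in words gens n -> all (mem gens) s.
Proof.
elim: n s => [|n IH] s; first by rewrite inE => /eqP ->.
by case/allpairsP => -[s' e] [/IH s'g eg ->]; rewrite all_rcons /= eg.
Qed.

Lemma trace_prob_rcons n s e : s \in words gens n -> e \in gens ->
  tp (rcons s e) = 4^-1 * tp s.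
Proof.
move=> /words_gens sg eg; rewrite !trace_prob_steps ?all_rcons //=.
  by rewrite size_rcons exprS.
by rewrite sg andbT.
Qed.

(** Given the history, the next step is uniform on the four generators, so harmonicity keeps the
    mean constant in time. *)
Lemma expectation_harmonic (f : G -> R) n :
  (forall g, \sum_(e <- gens) f (g * e)%g = 4 * f g) ->
  (\int[P]_t (f (X n t))%:E = (f 1%g)%:E)%E.
Proof.
move=> hf.
have E m : (\int[P]_t (f (X m t))%:E =
    (\sum_(s <- words gens m) f (word_prod s) * tp s)%:E)%E.
  under eq_integral do rewrite walk_trace.
  rewrite (expectation_trace _ _ _ _ _ Y gens _ ugens steps_gens m
    (fun s => f (word_prod s))) //.
rewrite E; congr EFin; elim: n => [|n IH].
  by rewrite big_seq1 /word_prod big_nil trace_prob_steps //= expr0 mulr1.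
rewrite big_wordsS -IH; apply: eq_big_seq => s sn.
rewrite big_seq; under eq_bigr => e eg do
  rewrite word_prod_rcons (trace_prob_rcons _ _ _ sn eg).
by rewrite -big_seq -big_distrl /= hf; field.
Qed.

Section Escape.
Variables (w : letter -> R) (kappa B : R).
Hypotheses (w1 : forall u, ~~ nontrivial u -> w u = 0)
  (w_inl : forall z : gT1, z != 1%g ->
     w (inl (z * a)%g) + w (inl (z * a^-1)%g) = 2 * w (inl z) - 2)
  (w_inr : forall z : gT2, z != 1%g ->
     w (inr (z * b)%g) + w (inr (z * b^-1)%g) = 2 * w (inr z) - 2)
  (w_a : w (inl a) + w (inl a^-1%g) = 2 * kappa)
  (w_b : w (inr b) + w (inr b^-1%g) = 2 * kappa)
  (wB : forall u, 0 <= w u <= B) (w_ge1 : forall u, nontrivial u -> 1 <= w u)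
  (kappa1 : 1 < kappa).
Local Notation wt := (weight w).

(** [martingale_average] applies to the compensated increments, viewed as functions of the history:
    [weight_gens] centres them and B + kappa bounds them. *)
Lemma walk_averages : {ae P, forall t,
  (\sum_(0 <= i < n) (wt (X i t * x i t)%g - wt (X i t)
     - mean_step kappa (X i t))) / n%:R @[n --> \oo] --> (0 : R)}.
Proof.
pose D s e := wt (word_prod s * e)%g - wt (word_prod s)
  - mean_step kappa (word_prod s).
have H := martingale_average d T R P G Y gens 1%g (fun n e => mY n [set e])
  ugens steps_gens D (B + kappa).
have : {ae P, forall t, (\sum_(0 <= i < n) D (trace Y i t) (x i t)) / n%:R
   @[n --> \oo] --> (0 : R)}.
  apply: H => [n s sn|n s e sn eg].
    rewrite big_seq; under eq_bigr => e eg do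
      rewrite (trace_prob_rcons _ _ _ sn eg) mulrA.
    rewrite -big_seq -big_distrl -mulr_suml /= (_ : \sum_(_ <- _) _ = 0) ?mul0r //.
    rewrite sumrB (weight_gens _ _ _ a b a1 b1 w kappa) //.
    rewrite !big_cons big_nil /mean_step; case: ifP => _; lra.
  have := weight_step _ _ _ a b a1 b1 w (word_prod s) e B wB eg.
  rewrite /D; move: (_ - wt (word_prod s)) => z hz.
  apply: le_trans (ler_normB _ _) _; rewrite lerD // /mean_step.
  have := kappa1; case: ifP => _ k1; rewrite ger0_norm; lra.
apply: filterS => t; apply: cvg_trans.
apply: near_eq_cvg; apply: nearW => n; congr (_ / _).
by apply: eq_bigr => i _; rewrite /D walk_trace.
Qed.

Lemma walk_escapes : {ae P, forall t,
  [/\ forall n, x n t \in gens, escapes (X ^~ t) &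
      wt (X n t) / n%:R @[n --> \oo] --> (kappa - 1) / 2]}.
Proof.
near=> t.
have Wt : (\sum_(0 <= i < n) (wt (X i t * x i t)%g - wt (X i t)
     - mean_step kappa (X i t))) / n%:R @[n --> \oo] --> (0 : R).
  by near: t; exact: walk_averages.
have St : forall n, x n t \in gens by near: t; exact: steps_gens.
split=> //.
  exact: (weight_escapes R gT1 gT2 a (X ^~ t) (x ^~ t) a1 erefl
    (fun=> erefl) w kappa B).
exact: (weight_speed R gT1 gT2 a (X ^~ t) (x ^~ t) a1 erefl
    (fun=> erefl) w kappa B).
Unshelve. all: by end_near. Qed.

Lemma limit_word_exists : exists Xoo : {RV P >-> IW},
  {ae P, forall t, converges_letterwise (X ^~ t) (Xoo t)}.
Proof.
pose L j u := [set t | \forall n \near \oo,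
  (j < size (nf (X n t)))%N /\ nth (inl 1%g) (nf (X n t)) j = u].
have mL j u : measurable (L j u).
  rewrite (_ : L j u = \bigcup_N \bigcap_(n in [set n | (N <= n)%N])
    (trace Y n @^-1` [set s | (j < size (nf (word_prod s)))%N /\
       nth (inl 1%g) (nf (word_prod s)) j = u])).
    apply: bigcupT_measurable => N; apply: bigcap_measurable => //.
      by exists N => /=.
    move=> n _; apply: measurable_discrete_preimage; exact: measurable_trace.
  apply/seteqP; split => t.
    by move=> [N _ hN]; exists N => // n /hN /=; rewrite walk_trace.
  by move=> [N _ hN]; exists N => // n /hN /=; rewrite walk_trace.
(* Where no letter is eventually constant at place j, a null event, the word takes the trivial
   letter [inl 1] as default value. *)
pose f t : IW := fun j => odflt (inl 1%g) [pick u | `[< L j u t >]].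
have Luniq j u v t : L j u t -> L j v t -> u = v.
  move=> [N _ hN] [M _ hM].
  have [_ <-] := hN (maxn N M) (leq_maxl _ _).
  by have [_ <-] := hM (maxn N M) (leq_maxr _ _).
have fE j u t : L j u t -> f t j = u.
  move=> Lu; rewrite /f; case: pickP => [v /asboolP Lv|/(_ u)/asboolP//].
  exact: Luniq Lv Lu.
have mf : measurable_fun [set: T] f.
  apply: measurable_to_words => j u.
  (* The letter at j depends only on which of the finitely many events [L j v] hold, as recorded by
     Q, so measurability reduces to that of Q. *)
  pose Q t := [ffun v => `[< L j v t >]].
  rewrite (_ : [set t | f t j = u] =
    Q @^-1` [set h | odflt (inl 1%g) [pick v | h v] = u]).
    apply: measurable_discrete_preimage => h.
    rewrite (_ : _ @^-1` _ = \bigcap_(v : letter)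
      (if h v then L j v else ~` L j v)).
      apply: fin_bigcap_measurable => [|v _]; first exact: finite_finset.
      by case: ifP => // _; exact: measurableC.
    apply/seteqP; split => t /=.
      move=> <- v _; rewrite ffunE; case: ifPn => /asboolP //.
    move=> H; apply/ffunP => v; rewrite ffunE; have := H v I.
    by case: ifP => _ hv; [apply/asboolP | apply/asboolPn].
  apply/seteqP; split => t /=; rewrite /f => <-; congr odflt;
    by apply: eq_pick => v; rewrite ffunE.
exists (HB.pack f (isMeasurableFun.Build _ _ _ _ f mf) : {mfun T >-> IW}).
apply: filterS walk_escapes => t [St esc _].
have [l hl] := escapes_converges gT1 gT2 a b (X ^~ t) (x ^~ t) a1 b1
    (fun=> erefl) St esc.
by move=> j; rewrite /= (fE j (l j)) //; exact: hl.
Qed.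

End Escape.
Section Limit.
Variables (q w : letter -> R) (y kappa B beta mean : R).
Hypotheses (q1 : forall u, ~~ nontrivial u -> q u = 1)
  (q_inl : forall z : gT1, z != 1%g ->
     q (inl (z * a)%g) + q (inl (z * a^-1)%g) = 2 * (2 - y) * q (inl z))
  (q_inr : forall z : gT2, z != 1%g ->
     q (inr (z * b)%g) + q (inr (z * b^-1)%g) = 2 * (2 - y) * q (inr z))
  (q_a : q (inl a) + q (inl a^-1%g) = 2 * y)
  (q_b : q (inr b) + q (inr b^-1%g) = 2 * y)
  (q_inv : forall u, q (letter_inv u) = q u)
  (q_bound : forall u, nontrivial u -> 0 < q u <= beta) (beta1 : beta < 1)
  (q_sumr : \sum_(z : gT2 | z != 1%g) q (inr z) = 1)
  (q_suml : \sum_(z : gT1 | z != 1%g) q (inl z) = 1).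
Variable Xoo : {RV P >-> IW}.
Hypothesis cvg_X : {ae P, forall t, converges_letterwise (X ^~ t) (Xoo t)}.

Let beta0 : 0 < beta.
Proof.
have /q_bound/andP[h1 h2] : nontrivial (inl a : letter) by [].
exact: lt_le_trans h1 h2.
Qed.

Lemma green_inv g : green q g^-1%g = green q g.
Proof.
rewrite /green -[nf g^-1%g]/(word_inv (nf g)) /word_inv.
rewrite (perm_big (map (@letter_inv gT1 gT2) (nf g))) /=; last by rewrite perm_rev.
by rewrite big_map; apply: eq_bigr => u _.
Qed.

Lemma green01 g : 0 < green q g <= 1.
Proof.
have /andP[-> /= h] := green_le R gT1 gT2 q g beta q_bound.
by apply: le_trans h _; rewrite exprn_ile1 // ltW.
Qed.

(** The length of g^-1 X_n is at least that of X_n minus that of g, so [green] tends to 0 at a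
    geometric rate in the length, and the prefix test is eventually constant. *)
Lemma cone_prob_cvg g t : converges_letterwise (X ^~ t) (Xoo t) ->
  cone_prob q g (X n t) @[n --> \oo] -->
  (\1_(Xoo @^-1` cylinder (nf g)) t : R).
Proof.
move=> ct; have green0 : green q (g^-1 * X n t)%g @[n --> \oo] --> (0 : R).
  apply/cvgr0Pnorm_lt => e e0.
  have [N hN] : exists N, beta ^+ N < e.
    have /cvgr0Pnorm_lt/(_ e e0)[N _ hN] : beta ^+ n @[n --> \oo] --> (0 : R).
      by apply: cvg_expr; rewrite ger0_norm ?ltW.
    by exists N; apply: le_lt_trans (hN N (leqnn _)); exact: ler_norm.
  apply: filterS (converges_escapes _ _ _ _ ct (N + size (nf g))%N) => n hn.
  have /andP[h0 h1] := green_le R gT1 gT2 q (g^-1 * X n t)%g beta q_bound.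
  rewrite gtr0_norm //; apply: le_lt_trans h1 (le_lt_trans _ hN).
  rewrite ler_wiXn2l ?(ltW beta0) ?(ltW beta1) // -(leq_add2r (size (nf g))).
  apply: leq_trans hn _; rewrite addnC.
  by apply: leq_trans (size_mulg _ _ _ _); rewrite mulKVg.
rewrite indicE; have -> : (t \in Xoo @^-1` cylinder (nf g)) =
   (mkseq (Xoo t) (size (nf g)) == nf g).
  by apply/idP/eqP; rewrite inE.
have := converges_prefix _ _ _ _ ct (nf g).
case: eqP => _ pr.
  have : 1 - green q (g^-1 * X n t)%g / 2 @[n --> \oo] --> (1 - 0 / 2 : R).
    by apply: cvgB; [exact: cvg_cst | apply: cvgMl].
  rewrite mul0r subr0; apply: cvg_trans; apply: near_eq_cvg.
  by apply: filterS pr => n; rewrite /cone_prob => ->.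
have : green q (g^-1 * X n t)%g / 2 @[n --> \oo] --> (0 / 2 : R).
  by apply: cvgMl.
rewrite mul0r; apply: cvg_trans; apply: near_eq_cvg.
by apply: filterS pr => n; rewrite /cone_prob => ->.
Qed.

Lemma measurable_limit_cylinder s : measurable (Xoo @^-1` cylinder s).
Proof.
rewrite -[_ @^-1` _]setTI; apply: measurable_funPT => //.
exact: measurable_cylinder.
Qed.

(** The cone probability is bounded and harmonic, so its expectation along the walk is its value at
    the identity, green g / 2; dominated convergence passes this to the limit word. *)
Lemma limit_cylinder g : g != 1%g ->
  P (Xoo @^-1` cylinder (nf g)) = (green q g / 2)%:E.
Proof.
move=> g1; pose f n t := (cone_prob q g (X n t))%:E.
pose l t : \bar R := (\1_(Xoo @^-1` cylinder (nf g)) t)%:E.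
have f01 h : 0 <= cone_prob q g h <= 1.
  have /andP[h0 h1] := green01 (g^-1 * h)%g.
  by rewrite /cone_prob; case: ifP => _; apply/andP; split; lra.
have mf n : measurable_fun [set: T] (f n).
  apply/measurable_EFinP.
  rewrite (_ : (fun t => _) = (fun s => cone_prob q g (word_prod s))
    \o trace Y n); last by apply/funext => t; rewrite /= walk_trace.
  apply: measurable_discrete_fun; apply: measurable_trace => m e; exact: mY.
have ml : measurable_fun [set: T] l.
  by apply/measurable_EFinP/measurable_indic; exact: measurable_limit_cylinder.
have [|||_ _] := @dominated_convergence _ T R P setT measurableT f l (cst 1%E) mf ml.
- apply: filterS cvg_X => t ct _; apply: cvg_EFin; first exact: nearW.
  exact: cone_prob_cvg.
- exact: finite_measure_integrable_cst.
- apply: nearW => t n _; rewrite lee_fin ger0_norm; by have /andP[] := f01 (X n t).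
rewrite integral_indic ?setIT //; last exact: measurable_limit_cylinder.
have E n : (\int[P]_t f n t = (cone_prob q g 1%g)%:E)%E.
  apply: expectation_harmonic => h.
  exact: (cone_prob_gens R gT1 gT2 a b a1 b1 q y).
rewrite (_ : [sequence _]_n = cst (cone_prob q g 1%g)%:E);
  last by apply/funext => n; rewrite /= E.
move=> /(cvg_unique _ (cvg_cst _)) <- //.
rewrite /cone_prob mulg1 green_inv; case: ifP => //.
rewrite prefixs0 => /eqP gE; case/eqP: g1; exact: val_inj.
Qed.

Lemma limit_normal : P (Xoo @^-1` @infinite_normal_form gT1 gT2) = 1%E.
Proof.
apply: ae_probability1.
  rewrite -[_ @^-1` _]setTI; apply: measurable_funPT => //.
  exact: measurable_normal_words.
by apply: filterS cvg_X => t; exact: converges_normal.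
Qed.

Lemma limit_cylinder_nf s u : normal_form (rcons s u) ->
  P (Xoo @^-1` cylinder (rcons s u)) = (\prod_(v <- s) q v * (q u / 2))%:E.
Proof.
move=> nfs; have g1 : FreeProduct nfs != 1%g.
  by apply/eqP => /(congr1 (@nf gT1 gT2)) /=; case: (s).
rewrite -[rcons s u]/(nf (FreeProduct nfs)) limit_cylinder // /green /=.
by rewrite -cats1 big_cat big_seq1 /= mulrA.
Qed.

Hypotheses (w1 : forall u, ~~ nontrivial u -> w u = 0)
  (w_inl : forall z : gT1, z != 1%g ->
     w (inl (z * a)%g) + w (inl (z * a^-1)%g) = 2 * w (inl z) - 2)
  (w_inr : forall z : gT2, z != 1%g ->
     w (inr (z * b)%g) + w (inr (z * b^-1)%g) = 2 * w (inr z) - 2)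
  (w_a : w (inl a) + w (inl a^-1%g) = 2 * kappa)
  (w_b : w (inr b) + w (inr b^-1%g) = 2 * kappa)
  (wB : forall u, 0 <= w u <= B) (w_ge1 : forall u, nontrivial u -> 1 <= w u)
  (kappa1 : 1 < kappa) (mean0 : 0 < mean)
  (w_meanl : \sum_(z : gT1 | z != 1%g) w (inl z) * q (inl z) = mean)
  (w_meanr : \sum_(z : gT2 | z != 1%g) w (inr z) * q (inr z) = mean).

(** The centred weights are martingale increments for the letters of the limit word: on each factor
    q is a distribution under which w has mean [mean]. *)
Lemma limit_average : {ae P, forall t,
  (\sum_(0 <= j < m) w (Xoo t j)) / m%:R @[m --> \oo] --> mean}.
Proof.
pose Y' (j : nat) (t : T) : letter := Xoo t j.
pose S' := index_enum (gT1 + gT2)%type.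
have mY' j u : measurable (Y' j @^-1` [set u]).
  rewrite (_ : _ @^-1` _ = Xoo @^-1` [set v | v j = u]) //.
  rewrite -[_ @^-1` _]setTI; apply: measurable_funPT => //.
  exact: measurable_letter.
have tpE s : trace_prob P Y' s = fine (P (Xoo @^-1` cylinder s)) by [].
have tp0 s : ~~ normal_form s -> trace_prob P Y' s = 0.
  move=> ns; rewrite tpE (probability_null_preimage _ _ _ P) //.
    exact: measurable_limit_cylinder.
  apply: filterS cvg_X => t ct /= E; case/negP: ns; rewrite -E.
  have [N _ hN] := converges_take _ _ _ _ ct (size s).
  rewrite -(hN N (leqnn _)); have := nfP (X N t).
  rewrite /normal_form => /andP[n1 n2]; apply/andP; split.
    by apply/allP => u /mem_take; exact: (allP n1).
  by rewrite take_sorted.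
have tp1 s u : normal_form (rcons s u) ->
    trace_prob P Y' (rcons s u) = \prod_(v <- s) q v * (q u / 2).
  by move=> ns; rewrite tpE limit_cylinder_nf.
have YS : {ae P, forall t n, Y' n t \in S'}.
  by apply: aeW => t n; exact: mem_index_enum.
have H := martingale_average d T R P _ Y' S' (inl 1%g) mY' (index_enum_uniq _) YS
  (fun _ u => w u - mean) (B + mean).
have : {ae P, forall t, (\sum_(0 <= i < n) (w (Xoo t i) - mean)) / n%:R
   @[n --> \oo] --> (0 : R)}.
  apply: H => [n s _|n s u _ _]; last first.
    apply: le_trans (ler_normB _ _) _; have /andP[h1 h2] := wB u.
    by rewrite lerD // ger0_norm // ltW.
  have side (gT : finGroupType) (f : gT -> letter) (c : R) :
      \sum_(z : gT | z != 1%g) q (f z) = 1 ->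
      \sum_(z : gT | z != 1%g) w (f z) * q (f z) = mean ->
      \sum_(z : gT | z != 1%g) (w (f z) - mean) * (c * (q (f z) / 2)) = 0.
    move=> sq sw.
    rewrite (eq_bigr (fun z => c / 2 * (w (f z) * q (f z) - mean * q (f z)))).
      by rewrite -big_distrr /= sumrB -big_distrr /= sq sw mulr1 subrr mulr0.
    by move=> z _; ring.
  have [ns|ns] := boolP (normal_form s); last first.
    rewrite big1 // => u _; rewrite tp0 ?mulr0 //.
    by apply: contra ns => /normal_form_rcons[].
  rewrite big_sumType /=.
  have tpF (gT : finGroupType) (h : gT -> letter) :
      (forall z, normal_form (rcons s (h z)) = (z != 1%g)) ->
      \sum_z (w (h z) - mean) * trace_prob P Y' (rcons s (h z)) =
      \sum_(z : gT | z != 1%g) (w (h z) - mean) * (\prod_(v <- s) q v * (q (h z) / 2)).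
    move=> hE; rewrite [RHS]big_mkcond; apply: eq_bigr => z _.
    by rewrite -hE; case: ifPn => nz; [rewrite tp1 | rewrite tp0 ?mulr0].
  have tpN (gT : finGroupType) (h : gT -> letter) :
      (forall z, ~~ normal_form (rcons s (h z))) ->
      \sum_z (w (h z) - mean) * trace_prob P Y' (rcons s (h z)) = 0.
    by move=> hE; rewrite big1 // => z _; rewrite tp0 ?mulr0.
  (* The first letter may come from either factor, every later one only from the factor opposite to
     its predecessor. *)
  case/lastP: s ns tpF tpN => [|s [v|v]] ns tpF tpN.
  - rewrite tpF => [|z]; last by rewrite /normal_form /= !andbT.
    rewrite tpF => [|z]; last by rewrite /normal_form /= !andbT.
    by rewrite (side _ inl) // (side _ inr) // addr0.
  - rewrite tpN => [|z]; last by rewrite normal_form_rcons2 /= !andbF.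
    rewrite tpF => [|z]; last by rewrite normal_form_rcons2 ns andbT.
    by rewrite (side _ inr) // addr0.
  - rewrite tpF => [|z]; last by rewrite normal_form_rcons2 ns andbT.
    rewrite tpN => [|z]; last by rewrite normal_form_rcons2 /= !andbF.
    by rewrite (side _ inl) // addr0.
apply: filterS => t H'.
have : (\sum_(0 <= i < n) (w (Xoo t i) - mean)) / n%:R + mean
   @[n --> \oo] --> (0 + mean : R) by apply: cvgD => //; exact: cvg_cst.
rewrite add0r; apply: cvg_trans; apply: near_eq_cvg.
exists 1%N => // n /= n0.
have n0' : n%:R != 0 :> R by rewrite pnatr_eq0 -lt0n.
by rewrite sumrB sumr_const_nat subn0 -mulr_natr; field.
Qed.

(** The drift is the speed (kappa - 1) / 2 of the weight divided by the mean weight of a letter of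
    the limit word. *)
Lemma walk_drift : is_drift P X ((kappa - 1) / 2 / mean).
Proof.
have esc := walk_escapes w kappa B w1 w_inl w_inr w_a w_b wB w_ge1 kappa1.
rewrite /is_drift; near=> t.
have ct : converges_letterwise (X ^~ t) (Xoo t) by near: t; exact: cvg_X.
have [St _ speed] : [/\ forall n, x n t \in gens, escapes (X ^~ t) &
    weight w (X n t) / n%:R @[n --> \oo] --> (kappa - 1) / 2].
  by near: t; exact: esc.
have avg : (\sum_(0 <= j < m) w (Xoo t j)) / m%:R @[m --> \oo] --> mean.
  by near: t; exact: limit_average.
apply: (size_speed R gT1 gT2 a b (X ^~ t) (x ^~ t) a1 b1 (fun=> erefl) St w B wB
  w_ge1 (Xoo t) _ _ _ mean0 ct speed avg).
by rewrite divr_gt0 // subr_gt0.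
Unshelve. all: by end_near. Qed.

End Limit.

End RandomWalk.

(** * Letter data of a cyclic factor *)

Section CyclicFactor.
Variables (R : realType) (gT : finGroupType) (a : gT) (k : nat).
Hypotheses (gen_a : [set: gT]%SET = <[a]>%g) (order_a : #[a]%g = k) (k3 : (3 <= k)%N).

Let k0 : (0 < k)%N. Proof. exact: leq_trans k3. Qed.

Lemma expg_small_inj i j : (i < k)%N -> (j < k)%N ->
  (a ^+ i = a ^+ j)%g -> i = j.
Proof.
move=> ik jk /eqP; rewrite eq_expg_mod_order order_a !modn_small //.
by move/eqP.
Qed.

Let pow (i : 'I_k) : gT := (a ^+ i)%g.

Let pow_bij : bijective pow.
Proof.
apply: inj_card_bij; first by move=> i j /expg_small_inj h; apply/val_inj/h.
by rewrite card_ord -order_a /order -gen_a cardsT.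
Qed.

Lemma cyclic_expg (z : gT) : z != 1%g -> exists2 i, (0 < i < k)%N & z = (a ^+ i)%g.
Proof.
have [p _ pK] := pow_bij => z1; exists (p z : nat); last by rewrite -[LHS]pK.
rewrite ltn_ord andbT lt0n; apply: contraNneq z1 => pz.
by rewrite -(pK z) /pow pz expg0.
Qed.

Lemma expg_neq1 i : (0 < i < k)%N -> (a ^+ i != 1)%g.
Proof.
move=> /andP[i0 ik]; apply/eqP; rewrite -(expg0 a) => /expg_small_inj h.
by rewrite (h ik k0) in i0.
Qed.

Lemma cyclic_sum (f : gT -> R) :
  \sum_(z : gT | z != 1%g) f z = \sum_(0 <= i < k.-1) f (a ^+ i.+1)%g.
Proof.
rewrite (reindex pow); last exact: onW_bij.
rewrite big_mkcond /= -(big_mkord xpredT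
  (fun i => if (a ^+ i != 1)%g then f (a ^+ i)%g else 0)).
rewrite -[X in index_iota _ X](prednK k0) big_nat_recl // eqxx /= add0r.
rewrite !big_nat; apply: eq_bigr => i /andP[_ ik].
by rewrite expg_neq1 // /= -ltn_predRL.
Qed.

Lemma expgV_order i : (i <= k)%N -> (a ^- i = a ^+ (k - i))%g.
Proof.
move=> ik; apply: (mulgI (a ^+ i)%g).
by rewrite mulgV -expgD subnKC // -order_a expg_order.
Qed.

Let expg_k : (a ^+ k = 1)%g. Proof. by rewrite -order_a expg_order. Qed.

(** A nontrivial element is a^(i+1) with i + 1 < k. As h is given on 0, ..., k, where 0 and k stand
    for the same element, both neighbours are covered without wrap-around. *)
Lemma cyclic_second_diff (f : gT -> R) (h : nat -> R) (c m : R) :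
  (forall i, (i <= k)%N -> f (a ^+ i)%g = h i) ->
  (forall i, (i.+2 <= k)%N -> h i.+2 + h i = c * h i.+1 - m) ->
  forall z, z != 1%g -> f (z * a)%g + f (z * a^-1)%g = c * f z - m.
Proof.
move=> fh hh z /cyclic_expg[[//|i] /andP[_ ik] ->].
rewrite -expgSr (_ : a ^+ i.+1 * a^-1 = a ^+ i)%g; last by rewrite expgSr mulgK.
by rewrite !fh ?hh // ltnW // ltnW.
Qed.

(** The parabola i (k - i) vanishes at both 0 and k, so it defines a function on the group; off the
    identity both of its factors are at least 1. *)
Lemma cyclic_parabola : exists W : gT -> R,
  [/\ forall i, (i <= k)%N -> W (a ^+ i)%g = i%:R * (k%:R - i%:R),
      forall z, 0 <= W z <= k%:R ^+ 2 & forall z, z != 1%g -> 1 <= W z].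
Proof.
have [p powK pK] := pow_bij.
exists (fun z => (p z)%:R * (k%:R - (p z)%:R)); split.
- move=> i; rewrite leq_eqVlt => /predU1P[->|ik].
    rewrite subrr mulr0 expg_k (_ : p 1%g = Ordinal k0) ?mul0r //.
    by rewrite -(powK (Ordinal k0)) /pow expg0.
  by rewrite (_ : p (a ^+ i)%g = Ordinal ik) // -(powK (Ordinal ik)).
- move=> z; have pk : (p z)%:R <= k%:R :> R by rewrite ler_nat ltnW.
  have p0 : 0 <= (p z)%:R :> R by [].
  by apply/andP; split; nra.
- move=> z z1; have pk : (p z)%:R + 1 <= k%:R :> R.
    by rewrite natr1 ler_nat.
  have p0 : 1 <= (p z)%:R :> R.
    rewrite ler1n lt0n; apply: contraNneq z1 => pz.
    by rewrite -(pK z) /pow pz expg0.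
  nra.
Qed.

Variables (y : R) (Q : gT -> R).
Hypotheses (root : root_spec k y) (Q1 : Q 1%g = 1)
  (QF : forall i, (1 <= i <= k.-1)%N -> Q (a ^+ i)%g = F i y).

Let FE n : F n.+2 y = 2 * (2 - y) * F n.+1 y - F n y. Proof. by []. Qed.

(** The recurrence is invariant under i -> k - i, and the initial values agree: F_k = F_0 = 1 and
    F_{k-1} = F_1 = y. *)
Lemma F_sym i : (i <= k)%N -> F (k - i) y = F i y.
Proof.
case: root => Fk Fp _ _ _.
suff h j : (j < k)%N -> F (k - j) y = F j y /\ F (k - j.+1) y = F j.+1 y.
  case: i => [|i ik]; first by rewrite subn0 Fk.
  by case: (h i ik).
elim: j => [|j IH] jk; first by rewrite subn0 Fk subn1 Fp.
have [IH1 IH2] := IH (ltnW jk); split=> //.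
have E : (k - j = (k - j.+2).+2)%N by lia.
have E' : (k - j.+1 = (k - j.+2).+1)%N by lia.
by move: IH1; rewrite E FE -E' IH2 FE => <-; ring.
Qed.

(** The equation F_k(y) = 1 = F_0(y) extends the formula consistently to the exponents 0 and k, both
    representing the identity. *)
Lemma QE i : (i <= k)%N -> Q (a ^+ i)%g = F i y.
Proof.
case: root => Fk _ _ _ _; case: i => [|i]; first by rewrite expg0 Q1.
rewrite leq_eqVlt => /predU1P[->|ik]; first by rewrite expg_k Q1 Fk.
by apply: QF; lia.
Qed.

Lemma cyclic_harmonic z : z != 1%g ->
  Q (z * a)%g + Q (z * a^-1)%g = 2 * (2 - y) * Q z.
Proof.
move=> z1; rewrite -[RHS]subr0.
apply: (cyclic_second_diff _ (fun i => F i y)) z1 => [i ik|i ik]; first exact: QE.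
by rewrite FE; ring.
Qed.

Lemma cyclic_harmonic1 : Q a + Q a^-1%g = 2 * y.
Proof.
have k1 : (1 <= k)%N by [].
have := expgV_order 1 k1; rewrite expg1 => ->; rewrite -{1}(expg1 a) !QE ?leq_subr //.
by rewrite F_sym //=; ring.
Qed.

Lemma cyclic_inv z : Q z^-1%g = Q z.
Proof.
have [->|/cyclic_expg[i /andP[_ ik] ->]] := eqVneq z 1%g; first by rewrite invg1.
have ik' := ltnW ik.
by rewrite (expgV_order _ ik') (QE _ (leq_subr i k)) (QE _ ik') (F_sym _ ik').
Qed.

Lemma cyclic_bound : exists2 beta, beta < 1 & forall z, z != 1%g -> 0 < Q z <= beta.
Proof.
case: root => _ _ F01 _ _.
exists (\big[Num.max/0]_(z : gT | z != 1%g) Q z).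
  apply: bigmax_lt => // z /cyclic_expg[i ik ->].
  have /andP[i0 ik'] := ik; rewrite QE ?(ltnW ik') //.
  by have /andP[] := F01 i ik.
move=> z z1; rewrite le_bigmax_cond // andbT.
have [i ik ->] := cyclic_expg z z1.
have /andP[_ ik'] := ik; rewrite QE ?(ltnW ik') //.
by have /andP[] := F01 i ik.
Qed.

Lemma cyclic_sumQ : \sum_(z : gT | z != 1%g) Q z = 1.
Proof.
case: root => _ _ _ S _; rewrite cyclic_sum -[RHS]S !big_nat.
by apply: eq_bigr => i ik; rewrite QF //; lia.
Qed.

Lemma cyclic_sumWQ (W : gT -> R) :
  (forall i, (i <= k)%N -> W (a ^+ i)%g = i%:R * (k%:R - i%:R)) ->
  \sum_(z : gT | z != 1%g) W z * Q z = (k%:R - 2) / (1 - y).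
Proof.
move=> WE; case: root => _ _ _ _ S; rewrite cyclic_sum -[RHS]S !big_nat.
by apply: eq_bigr => i ik; rewrite WE ?QF //; lia.
Qed.

(** The parabola has second difference -2, and both a and a^-1 weigh k - 1, which identifies kappa
    as k - 1. *)
Lemma cyclic_parabola_diff (W : gT -> R) :
  (forall i, (i <= k)%N -> W (a ^+ i)%g = i%:R * (k%:R - i%:R)) ->
  (forall z, z != 1%g -> W (z * a)%g + W (z * a^-1)%g = 2 * W z - 2) /\
  W a + W a^-1%g = 2 * (k%:R - 1).
Proof.
move=> WE; split.
  apply: (cyclic_second_diff _ (fun i => i%:R * (k%:R - i%:R)) _ _ WE) => i _.
  by rewrite -!natr1; ring.
have k1 : (1 <= k)%N by [].
have := expgV_order 1 k1; rewrite expg1 => ->; rewrite -{1}(expg1 a) !WE ?leq_subr //.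
by rewrite natrB //; ring.
Qed.

End CyclicFactor.

Lemma generator_Zp (k : nat) (a : 'Z_k) : (3 <= k)%N ->
  generator [set: 'Z_k]%SET a -> [set: 'Z_k]%SET = <[a]>%g /\ #[a]%g = k.
Proof.
move=> k3 /eqP genE; split=> //.
by rewrite /order -genE cardsT card_ord Zp_cast // (leq_trans _ k3).
Qed.

(** * Masses of letters and distinctness of the generators *)

Section Masses.
Variables (R : realType) (gT1 gT2 : finGroupType) (r : gT1 + gT2 -> R).

Lemma mass_Sigma : mass r (Sigma gT1 gT2) =
  \sum_(z | z != 1%g) r (inl z) + \sum_(z | z != 1%g) r (inr z).
Proof.
by rewrite /mass big_sumType; congr (_ + _); apply: eq_bigl => z; rewrite inE.
Qed.

Lemma mass_compl_inl z :
  mass r (Sigma gT1 gT2 :\: Sigma_of (inl z))%SET = \sum_(z | z != 1%g) r (inr z).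
Proof.
rewrite /mass big_sumType /= big1 => [|y]; last by rewrite !inE /=; case: (y != 1%g).
by rewrite add0r; apply: eq_bigl => y; rewrite !inE /= andbF.
Qed.

Lemma mass_compl_inr z :
  mass r (Sigma gT1 gT2 :\: Sigma_of (inr z))%SET = \sum_(z | z != 1%g) r (inl z).
Proof.
rewrite /mass big_sumType /= addrC big1 => [|y].
  by rewrite add0r; apply: eq_bigl => y; rewrite !inE /= andbF.
by rewrite !inE /=; case: (y != 1%g).
Qed.

End Masses.

Lemma gens_uniq (gT1 gT2 : finGroupType) (a : gT1) (b : gT2) :
  a != 1%g -> b != 1%g -> (a * a != 1)%g -> (b * b != 1)%g -> uniq (gens a b).
Proof.
move=> a1 b1 aa bb.
have inj u v : nontrivial u -> u != v ->
    fp_letter u != fp_letter v :> free_product gT1 gT2.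
  move=> nu; apply: contraNneq => /(congr1 (@nf gT1 gT2)).
  by rewrite !fp_letterE nu; case: ifP => // _ [->].
have aV : a != (a^-1)%g by rewrite -mulg_eq1.
have bV : b != (b^-1)%g by rewrite -mulg_eq1.
by rewrite /gens !fp_letterV /= !inE !negb_or /= !inj //= ?invg_eq1.
Qed.

(** * Two copies of Z/k: harmonic measure, drift and its limit in k *)

Theorem theorem2p3 (R : realType) :
  (forall k : nat, (3 <= k)%N ->
     exists! y : R, 0 < y < 1 /\ F k y = 1) /\
  (forall x : nat -> R,
     (forall k : nat, (3 <= k)%N -> 0 < x k < 1 /\ F k (x k) = 1) ->
     let gamma := fun k : nat => (1 - x k) / 2 in
     [/\ forall (k : nat) (a b : 'Z_k)
           (mu : probability (free_product 'Z_k 'Z_k) R)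
           (r : 'Z_k + 'Z_k -> R)
           (d : measure_display) (T : measurableType d) (P : probability T R)
           (steps : nat -> {RV P >-> free_product 'Z_k 'Z_k}),
           (3 <= k)%N ->
           generator [set: 'Z_k]%SET a ->
           generator [set: 'Z_k]%SET b ->
           (forall g : free_product 'Z_k 'Z_k,
              g \in [:: fp_letter (inl a); (fp_letter (inl a))^-1%g;
                        fp_letter (inr b); (fp_letter (inr b))^-1%g] ->
              mu [set g] = (4^-1)%:E) ->
           (forall i : nat, (1 <= i <= k.-1)%N ->
              r (inl (a ^+ i)%g) = F i (x k) / 2 /\
              r (inr (b ^+ i)%g) = F i (x k) / 2) ->
           iid mu steps ->
           [/\ exists nu : probability (infinite_word 'Z_k 'Z_k) R,
                 harmonic_measure P (walk steps) nu,
               forall nu : probability (infinite_word 'Z_k 'Z_k) R,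
                 harmonic_measure P (walk steps) nu ->
                 markovian_multiplicative r nu &
               is_drift P (walk steps) (gamma k)],
         forall k l : nat, (3 <= k)%N -> (k < l)%N -> gamma k < gamma l &
         gamma k @[k --> \oo] --> (3^-1 : R)]).
Proof.
split; first by move=> k; exact: root_exists.
move=> x hx gamma; split; last first.
- exact: root_gamma_cvg.
- move=> k l k3 kl; have [xk Fk] := hx k k3.
  have [xl Fl] := hx l (leq_trans k3 (ltnW kl)).
  exact: root_gamma_incr k3 kl xk Fk xl Fl.
move=> k a b mu r d T P steps k3 ga gb mu_gens hr iid_steps.
have [x01 Fk] := hx k k3; have root := rootP R k (x k) k3 x01 Fk.
have [xk0 xk1] := andP x01.
have [genA ordA] := generator_Zp k a k3 ga.
have [genB ordB] := generator_Zp k b k3 gb.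
have k1 : (0 < 1 < k)%N by apply: leq_trans k3.
have a1 : a != 1%g by rewrite -(expg1 a); apply: expg_neq1 ordA k3 _ k1.
have b1 : b != 1%g by rewrite -(expg1 b); apply: expg_neq1 ordB k3 _ k1.
(* As k >= 3, neither generator is its own inverse, so the four steps are distinct. *)
have ugens : uniq (gens a b).
  apply: gens_uniq => //.
    by have := expg_neq1 _ a k ordA k3 2; apply.
  by have := expg_neq1 _ b k ordB k3 2; apply.
(* Each factor carries mass 1/2 of r, so 2 r is the transition weight [qweight]; the value 1 on
   trivial letters matches F_0 = F_k = 1. *)
pose q (u : 'Z_k + 'Z_k) : R := if nontrivial u then 2 * r u else 1.
have q1 u : ~~ nontrivial u -> q u = 1 by rewrite /q => /negPf->.
have QA1 : q (inl 1%g) = 1 by rewrite /q /nontrivial eqxx.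
have QB1 : q (inr 1%g) = 1 by rewrite /q /nontrivial eqxx.
have QA i : (1 <= i <= k.-1)%N -> q (inl (a ^+ i)%g) = F i (x k).
  move=> ik; rewrite /q /= (expg_neq1 _ a k ordA k3); last by lia.
  by rewrite (hr i ik).1; field.
have QB i : (1 <= i <= k.-1)%N -> q (inr (b ^+ i)%g) = F i (x k).
  move=> ik; rewrite /q /= (expg_neq1 _ b k ordB k3); last by lia.
  by rewrite (hr i ik).2; field.
have q_inl := cyclic_harmonic R _ a k genA ordA k3 (x k) (q \o inl) root QA1 QA.
have q_inr := cyclic_harmonic R _ b k genB ordB k3 (x k) (q \o inr) root QB1 QB.
have q_a := cyclic_harmonic1 R _ a k ordA k3 (x k) (q \o inl) root QA1 QA.
have q_b := cyclic_harmonic1 R _ b k ordB k3 (x k) (q \o inr) root QB1 QB.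
have q_invl := cyclic_inv R _ a k genA ordA k3 (x k) (q \o inl) root QA1 QA.
have q_invr := cyclic_inv R _ b k genB ordB k3 (x k) (q \o inr) root QB1 QB.
have q_suml := cyclic_sumQ R _ a k genA ordA k3 (x k) (q \o inl) root QA.
have q_sumr := cyclic_sumQ R _ b k genB ordB k3 (x k) (q \o inr) root QB.
have [ba ba1 q_bl] := cyclic_bound R _ a k genA ordA k3 (x k) (q \o inl) root QA1 QA.
have [bb bb1 q_br] := cyclic_bound R _ b k genB ordB k3 (x k) (q \o inr) root QB1 QB.
have [WA [WAE WAB WA1]] := cyclic_parabola R _ a k genA ordA k3.
have [WB [WBE WBB WB1]] := cyclic_parabola R _ b k genB ordB k3.
have [w_inl w_a] := cyclic_parabola_diff R _ a k genA ordA k3 WA WAE.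
have [w_inr w_b] := cyclic_parabola_diff R _ b k genB ordB k3 WB WBE.
have w_meanl := cyclic_sumWQ R _ a k genA ordA k3 (x k) (q \o inl) root QA WA WAE.
have w_meanr := cyclic_sumWQ R _ b k genB ordB k3 (x k) (q \o inr) root QB WB WBE.
pose w (u : 'Z_k + 'Z_k) : R := match u with inl z => WA z | inr z => WB z end.
have w1 u : ~~ nontrivial u -> w u = 0.
  case: u => z /=; rewrite negbK => /eqP ->.
    by rewrite -(expg0 a) WAE // mul0r.
  by rewrite -(expg0 b) WBE // mul0r.
have wB u : 0 <= w u <= k%:R ^+ 2 by case: u.
have w_ge1 u : nontrivial u -> 1 <= w u by case: u => z /=; [exact: WA1|exact: WB1].
pose beta := Num.max ba bb.
have beta1 : beta < 1 by rewrite gt_max ba1 bb1.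
have q_bound u : nontrivial u -> 0 < q u <= beta.
  case: u => z nz; rewrite le_max.
    by have /andP[-> ->] := q_bl z nz.
  by have /andP[-> ->] := q_br z nz; rewrite orbT.
have q_inv u : q (letter_inv u) = q u.
  by case: u => z; [exact: q_invl | exact: q_invr].
have k3R : 3 <= k%:R :> R by rewrite ler_nat.
have kappa1 : 1 < k%:R - 1 :> R by lra.
have mean0 : 0 < (k%:R - 2) / (1 - x k) by rewrite divr_gt0; lra.
have [Xoo cvgX] := limit_word_exists _ _ _ a b mu d T P steps a1 b1 ugens mu_gens
  iid_steps w _ _ w1 w_inl w_inr w_a w_b wB w_ge1 kappa1.
split.
- by exists (distribution P Xoo), Xoo.
(* The law is computed from an arbitrary limit word [Yoo], so every harmonic measure is covered. *)
- move=> nu [Yoo [cvgY nuE]].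
  have massl : \sum_(z : 'Z_k | z != 1%g) r (inl z) = 1 / 2.
    rewrite -[X in X / 2]q_suml big_distrl /=.
    by apply: eq_bigr => z nz; rewrite /q /= nz; field.
  have massr : \sum_(z : 'Z_k | z != 1%g) r (inr z) = 1 / 2.
    rewrite -[X in X / 2]q_sumr big_distrl /=.
    by apply: eq_bigr => z nz; rewrite /q /= nz; field.
  have qwE v : nontrivial v -> qweight r v = q v.
    move=> nv; rewrite /qweight [in RHS]/q nv.
    by case: v {nv} => z; rewrite ?mass_compl_inl ?mass_compl_inr ?massl ?massr; field.
  split.
  + move=> u; rewrite inE => nu'; have /andP[h0 h1] := q_bound u nu'.
    by move: h0 h1 beta1; rewrite /q nu' => h0 h1 h2; apply/andP; split; lra.
  + by rewrite mass_Sigma massl massr; field.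
  + rewrite nuE; last exact: measurable_normal_words.
    exact: (limit_normal _ _ _ _ _ _ _ _ cvgY).
  + move=> s u nfs; rewrite nuE; last exact: measurable_cylinder.
    rewrite [LHS](limit_cylinder_nf _ _ _ a b mu d T P steps a1 b1 ugens mu_gens
      iid_steps q (x k) beta q1 q_inl q_inr q_a q_b q_inv q_bound beta1 Yoo cvgY s u nfs).
    have [/andP[ns _] nu'] := normal_form_rcons _ _ _ _ nfs.
    congr (_ * _)%:E; last by rewrite /q nu'; field.
    by rewrite !big_seq; apply: eq_bigr => v vs; rewrite qwE //; exact: (allP ns).
(* With kappa = k - 1 and mean weight (k - 2) / (1 - x_k), the quotient of (k - 2) / 2 by the mean
   is (1 - x_k) / 2. *)
- have := walk_drift _ _ _ a b mu d T P steps a1 b1 ugens mu_gens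
      iid_steps q w (x k) _ _ beta _ q1 q_inl q_inr q_a q_b q_inv q_bound beta1
      q_sumr q_suml Xoo cvgX w1 w_inl w_inr w_a w_b wB w_ge1 kappa1 mean0 w_meanl w_meanr.
  congr is_drift; rewrite /gamma; field.
  by rewrite !gt_eqF //; lra.
Qed.
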